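(* For every integer $g\ge 3$, $$\frac{2^{g-2}-1}{g-2}\le f_g\le \frac{2^{g+2}-2}{g+2}.$$ In particular, $N_g\sim 2^{g-1}$ as $g\to\infty$.
   Context: For $g\ge1$ and $\delta=(\delta_1,\dots,\delta_g)\in\{0,1\}^g$, put $\varphi_i=\sum_{j\le i}\delta_j$ ($\varphi_0=0$), $P=\{i\mid\delta_i=1\}$, $Z=\{i\mid\delta_i=0\}$, $\varepsilon_i=2\delta_i-1\in\{\pm1\}$. The permutation $\pi_\delta$ of $\{1,\dots,g\}$ is defined by $\pi_\delta(i)=\varphi_i$ if $i\in P$ and $\pi_\delta(i)=g-(i-\varphi_i)+1$ if $i\in Z$. The cycles of $\pi_\delta$ (fixed points count as cycles) are viewed as subsets of $\{1,\dots,g\}$. For a cycle $C$ put $\varepsilon(C)=\prod_{i\in C}\varepsilon_i$. If $\varepsilon(C)=1$, an orientation of $C$ is a map $t_C:C\to\{\pm1\}$ with $t_C(\pi_\delta(i))=\varepsilon_i t_C(i)$ for all $i\in C$. A cycle $C$ is bad if $C\cap P\ne\emptyset$, $\varepsilon(C)=1$, and there is an orientation $t_C$ with $t_C(i)=1$ for all $i\in C\cap P$; this orientation is then unique and $t_C$ denotes it. A cycle that is not bad is good. The cycle graph $\Gamma_\delta$ is the directed graph whose vertices are the cycles of $\pi_\delta$, with an arrow $C\to C'$ iff $C\ne C'$, $C'$ is bad, and there are $i\in C\cap P$, $j\in C'\cap Z$ with $i<j$ and $t_{C'}(j)=1$. Condition $( * )_\delta$: every bad cycle is reachable in $\Gamma_\delta$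 by a directed path starting from a good cycle. $N_g$ is the number of $\delta\in\{0,1\}^g$ such that $( * )_\delta$ holds (for any odd prime $p$, this is also the number of Ekedahl-Oort strata of the moduli stack $\mathcal A_g$ of principally polarized abelian varieties of dimension $g$ in characteristic $p$ that meet the supersingular locus). Put $f_g=2^{g-1}-N_g$; since $( * )_\delta$ fails whenever $\delta_1=1$, $f_g$ is the number of $\delta\in\{0,1\}^g$ with $\delta_1=0$ for which $( * )_\delta$ fails. *)

(* Defs.v *)
From HB Require Import structures.
#[warnings="-notation-overridden,-ambiguous-paths"]
From mathcomp Require Import all_boot all_order all_algebra all_fingroup.
From mathcomp Require Import zify.

Set Implicit Arguments.
Unset Strict Implicit.
Unset Printing Implicit Defensive.

Import Order.TTheory GRing.Theory Num.Theory.
Local Open Scope ring_scope.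

(* The index set {1, ..., g} is represented by 'I_g = {0, ..., g - 1}: the     *)
(* ordinal i stands for the index i.+1.                                       *)

Section CycleGraph.

Variables (g : nat) (delta : {ffun 'I_g -> bool}).
Implicit Types (i j : 'I_g) (C : {set 'I_g}) (t : {ffun 'I_g -> bool}).

Definition phi (i : 'I_g) : nat := (\sum_(j < g | j <= i) delta j)%N.

Definition Pset : {set 'I_g} := [set i | delta i].

Definition Zset : {set 'I_g} := [set i | ~~ delta i].

Definition eps (i : 'I_g) : int := 2 * (delta i)%:R - 1.

(* pi_delta(i.+1) - 1 : phi i - 1 on Pset, and (g - (i.+1 - phi i) + 1) - 1 on Zset. *)
Definition pi_nat (i : 'I_g) : nat :=
  if delta i then (phi i).-1 else (g - (i.+1 - phi i))%N.

Let zeta (i : 'I_g) : nat := (\sum_(j < g | j <= i) ~~ delta j)%N.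

Let phi_zeta i : (phi i + zeta i = i.+1)%N.
Proof.
rewrite -big_split /= (eq_bigr (fun=> 1%N)); last by move=> j _; case: (delta j).
by rewrite -(big_ord_widen g (fun=> 1%N) (ltn_ord i)) sum1_card card_ord.
Qed.

Let count_lt (b : 'I_g -> bool) i j : (i < j)%N -> b j ->
  (\sum_(k < g | k <= i) b k < \sum_(k < g | k <= j) b k)%N.
Proof.
move=> ij bj; rewrite [X in (_ < X)%N](bigD1 j) //= bj add1n ltnS.
rewrite big_mkcond [X in (_ <= X)%N]big_mkcond /=; apply: leq_sum => k _.
case: ifP => // ki; rewrite (leq_trans ki (ltnW ij)) /=.
by case: eqVneq => // kj; rewrite kj leqNgt ij in ki.
Qed.

Let count_inj (b : 'I_g -> bool) i j : b i -> b j ->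
  (\sum_(k < g | k <= i) b k)%N = (\sum_(k < g | k <= j) b k)%N -> i = j.
Proof.
move=> bi bj e; apply: val_inj => /=.
case: (ltngtP i j) => // lt.
  by have := count_lt lt bj; rewrite e ltnn.
by have := count_lt lt bi; rewrite e ltnn.
Qed.

Let count_gt0 (b : 'I_g -> bool) i :
  b i -> (0 < \sum_(k < g | k <= i) b k)%N.
Proof. by move=> bi; rewrite (bigD1 i) //= bi. Qed.

Let phi_zeta_le i j : (phi i + zeta j <= g)%N.
Proof.
apply: (@leq_trans (\sum_(k < g) (delta k + ~~ delta k))%N).
  rewrite big_split /= leq_add //.
    by rewrite /phi big_mkcond; apply: leq_sum => k _; case: ifP.
  by rewrite /zeta big_mkcond; apply: leq_sum => k _; case: ifP.
rewrite (eq_bigr (fun=> 1%N)); last by move=> k _; case: (delta k).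
by rewrite sum1_card card_ord.
Qed.

Lemma pi_nat_lt i : (pi_nat i < g)%N.
Proof.
rewrite /pi_nat; have := phi_zeta i; have := ltn_ord i.
case: ifPn => di.
  by have := count_gt0 di; rewrite -/(phi i); lia.
by have := @count_gt0 (fun k => ~~ delta k) i di; rewrite -/(zeta i); lia.
Qed.

Definition pi_fun (i : 'I_g) : 'I_g := Ordinal (pi_nat_lt i).

Lemma pi_fun_inj : injective pi_fun.
Proof.
move=> i j /(congr1 val) /=; rewrite /pi_nat.
have := phi_zeta i; have := phi_zeta j.
have := phi_zeta_le i j; have := phi_zeta_le j i.
have := phi_zeta_le i i; have := phi_zeta_le j j.
case: ifPn => di; case: ifPn => dj => *.
- apply: (count_inj di dj); rewrite -/(phi i) -/(phi j).
  by have := count_gt0 di; have := count_gt0 dj; rewrite -/(phi i) -/(phi j); lia.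
- by have := count_gt0 di; rewrite -/(phi i); lia.
- by have := count_gt0 dj; rewrite -/(phi j); lia.
- apply: (@count_inj (fun k => ~~ delta k) i j di dj).
  by rewrite -/(zeta i) -/(zeta j); lia.
Qed.

Definition pi_perm : {perm 'I_g} := perm pi_fun_inj.

Definition cycles : {set {set 'I_g}} := porbits pi_perm.

Definition epsC (C : {set 'I_g}) : int := \prod_(i in C) eps i.

(* A map to {+1, -1} is encoded by the boolean function t of its signs, with  *)
(* value (-1) ^+ t i at i; only the restriction of t to C matters.            *)
Definition sgn (t : {ffun 'I_g -> bool}) (i : 'I_g) : int := (-1) ^+ t i.

Definition is_orientation (C : {set 'I_g}) (t : {ffun 'I_g -> bool}) : bool :=
  [forall i in C, sgn t (pi_perm i) == eps i * sgn t i].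

Definition is_pos_orientation C t : bool :=
  is_orientation C t && [forall i in C :&: Pset, sgn t i == 1].

Definition bad (C : {set 'I_g}) : bool :=
  [&& C \in cycles, C :&: Pset != set0, epsC C == 1
    & [exists t, is_pos_orientation C t]].

Definition good (C : {set 'I_g}) : bool := (C \in cycles) && ~~ bad C.

(* The orientation t_C of a bad cycle C (junk value if C is not bad); it is    *)
(* unique on C since C meets P.                                               *)
Definition orientation_of (C : {set 'I_g}) : {ffun 'I_g -> bool} :=
  odflt [ffun=> false] [pick t | is_pos_orientation C t].

Definition arrow : rel {set 'I_g} := fun C C' =>
  [&& C \in cycles, C' \in cycles, C != C', bad C'
    & [exists i in C :&: Pset, exists j in C' :&: Zset,
        (i < j)%N && (sgn (orientation_of C') j == 1)]].

Definition star : bool :=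
  [forall C, bad C ==> [exists C0, good C0 && connect arrow C0 C]].

End CycleGraph.

Definition Ng (g : nat) : nat := #|[set delta : {ffun 'I_g -> bool} | star delta]|.

Definition fg (g : nat) : int := 2 ^+ (g - 1) - (Ng g)%:Z.

(* Main.v *)
(* Compare positions by the letters of delta met when walking backwards along
   their cycle: pi_delta sends P before Z, preserves the order on P and reverses
   it on Z, so delta is determined by one cycle (as a cyclic word) together with
   the word left after deleting that cycle.

   Upper bound.  If the condition fails and delta_1 = 0, some bad cycle, read
   from a suitable element of Z of sign +, is a word 00 1^a_1 ... 00 1^a_s with
   all a_i <= r = a_s, and no r + 2 consecutive elements of any cycle lie in P.
   Such pairs inject into words of length g + 2 whose longest cyclic run of ones
   is unique and comes first: take 1^(r+2), the blocks 0 1^(a_i+1) for i < s, the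
   separator 00, and a run-bounded encoding of the remaining word.  The g + 2
   rotations of all these words are distinct and not constant.

   Lower bound.  Every nonzero word of length g - 2 has a rotation ending with a
   longest cyclic run; appending a 1 gives a word whose first occurrence of 1^k
   is at its end.  Sorting its letters by the number of ones just before them
   turns it into a delta for which the cycle of 1 is the word 00 1^(k-1); no
   arrow enters this bad cycle.

   Both bounds use that this sorting is injective: it compares words containing
   a run 1^k with words delta carrying k consecutive elements of P on a cycle. *)

Require Import Defs.
From mathcomp Require Import all_boot all_order all_algebra all_fingroup.
From mathcomp Require Import boolp zify.

Set Implicit Arguments.
Unset Strict Implicit.
Unset Printing Implicit Defensive.

(** * Binary words, levels and runs *)
Section Words.
Implicit Types (K i j n m s : nat) (b : bool) (d u v : seq bool).

(* Here and in [level], [s] is the number of ones read just before [v]. *)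
Fixpoint first_passage K s v : bool :=
  if v is b :: v' then (s < K) && first_passage K (if b then s.+1 else 0) v' else s == K.

Fixpoint level j s v : seq bool :=
  if v is b :: v' then
    let l := level j (if b then s.+1 else 0) v' in if s == j then b :: l else l
  else [::].

(** The counter reaches [j.+1] only through a one read at level [j], unless it starts there; each
    visit reads a letter, except the final one at [K]. *)
Lemma size_level K s v j : first_passage K s v ->
  size (level j.+1 s v) + (j.+1 == K) = count id (level j s v) + (s == j.+1).
Proof.
elim: v s => [|b v IH] s /=; first by move/eqP->; rewrite eq_sym.
case/andP=> sK /IH {IH}.
case: (eqVneq s j) => [e|sj]; case: (eqVneq s j.+1) => [e1|sj1]; case: b => /=;
  lia.
Qed.

(** The counter climbs by at most one per letter, so on its way from [s] to [K] it visits every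
    value between. *)
Lemma level_neq0 K s v j : first_passage K s v -> s <= j < K -> level j s v != [::].
Proof.
elim: v s => [|b v IH] s /=; first by move/eqP->; lia.
case/andP=> sK f sj; case: (eqVneq s j) => // ne.
by apply: (IH _ f); case: (b); lia.
Qed.

(** After a zero the counter restarts from 0 and must pass level [j] again, so the last visit to [j]
    reads a one. The default [true] covers an empty level. *)
Lemma last_level K s v j : first_passage K s v -> j < K -> last true (level j s v).
Proof.
elim: v s => [|b v IH] s //= /andP[sK f] jK; case: (eqVneq s j) => [e|_]; last exact: (IH _ f jK).
rewrite /=; case: b f => f; first exact: (IH _ f jK).
have := level_neq0 f (j := j); rewrite jK leq0n => /(_ isT).
by have := IH _ f jK; case: (level j 0 v).
Qed.

Lemma level_oversize K s v j : first_passage K s v -> K <= j -> level j s v = [::].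
Proof.
elim: v s => [|b v IH] s //= /andP[sK f] jK; case: (eqVneq s j) => [e|_]; first lia.
exact: (IH _ f jK).
Qed.

(** The current counter names the level that supplies the next letter, so [v] can be replayed from
    its levels. *)
Lemma level_inj K s v v' : first_passage K s v -> first_passage K s v' ->
  (forall j, level j s v = level j s v') -> v = v'.
Proof.
elim: v s v' => [|b v IH] s [|b' v'] //=.
- by move/eqP->; rewrite ltnn.
- by move=> /andP[+ _] /eqP e; rewrite e ltnn.
case/andP=> sK f /andP[_ f'] e.
have eb : b = b' by have := e s; rewrite eqxx => -[].
subst b'; congr (_ :: _); apply: (IH _ _ f f') => j.
by have := e j; case: eqP => // _ [].
Qed.

(* Reading a plane tree with all leaves at depth K in depth-first order as [v],
   sorting the letters by decreasing level gives its breadth-first order. *)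
Fixpoint by_level K s v i : seq bool :=
  if i is i'.+1 then by_level K s v i' ++ level (K - i) s v else [::].

Lemma size_by_level K s v i : size (by_level K s v i) = \sum_(j < i) size (level (K - j.+1) s v).
Proof. by elim: i => [|i IH] /=; rewrite ?big_ord0 // big_ord_recr size_cat IH. Qed.

Lemma size_by_levelK K v s : first_passage K s v -> size (by_level K s v K) = size v.
Proof.
rewrite size_by_level => f.
rewrite (reindex_inj rev_ord_inj) /=.
rewrite (eq_bigr (fun j : 'I_K => size (level j s v))); last first.
  by move=> j _; congr (size (level _ _ _)); have := ltn_ord j; lia.
elim: v s f => [|b v IH] s /=; first by move=> _; rewrite big1.
case/andP=> sK /IH <-.
rewrite (bigD1 (Ordinal sK)) //= eqxx [in RHS](bigD1 (Ordinal sK)) //=.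
rewrite addSn; congr (_ + _).+1; apply: eq_bigr => j; rewrite -val_eqE /= eq_sym.
by move/negPf->.
Qed.

(** * Chains of ones in the sorted word *)

(* This is pi_delta on the indices (from 0) of the ones of [d]. *)
Definition prev_one d y := (count id (take y.+1 d)).-1.

(** The fixed endpoint 0 makes the starting index unique for each [K]. On delta it costs no
    generality: a run of P before any index forces one before the first index ([past_run_le]). *)
Definition one_chain K d y :=
  [&& all (fun k => nth false d (iter k (prev_one d) y)) (iota 0 K)
    & iter K (prev_one d) y == 0].

Lemma one_chainS K d y : one_chain K.+1 d y = nth false d y && one_chain K d (prev_one d y).
Proof.
rewrite /one_chain /= -iterS iterSr -andbA; congr [&& _, _ & _].
rewrite -[1]/(1 + 0) iotaDl all_map; apply/eq_in_all => k _ /=.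
by rewrite -iterS iterSr.
Qed.

Lemma prev_one_inj d y y' : nth false d y -> nth false d y' -> prev_one d y = prev_one d y' -> y = y'.
Proof.
wlog lt : y y' / y < y' => [H h h' e|].
  case: (ltngtP y y') => // lt; first exact: (H y y').
  by apply/esym; apply: (H y' y).
move=> h h'; rewrite /prev_one.
have s' : y' < size d by rewrite ltnNge; apply: contraTN h' => ?; rewrite nth_default.
rewrite (take_nth false s') -cats1 count_cat /= h'.
have : count id (take y.+1 d) <= count id (take y' d).
  by rewrite -(subnKC lt) takeD count_cat leq_addr.
have s : y < size d by apply: ltn_trans s'.
rewrite (take_nth false s) -cats1 count_cat /= h.
lia.
Qed.

Lemma one_chain_inj K d y y' : one_chain K d y -> one_chain K d y' -> y = y'.
Proof.
elim: K y y' => [|K IH] y y'; first by rewrite /one_chain /= => /eqP-> /eqP->.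
rewrite !one_chainS => /andP[h1 /IH H] /andP[h2 /H]; exact: prev_one_inj.
Qed.

(** With a zero at index 0 a chain stops at its first visit there, which fixes its length. *)
Lemma one_chain_length K K' d y : ~~ nth false d 0 -> one_chain K d y -> one_chain K' d y -> K = K'.
Proof.
move=> d0; elim: K K' y => [|K IH] [|K'] y //; rewrite !one_chainS.
- by move=> /andP[_ /eqP /= ->]; rewrite (negPf d0).
- by move=> + /andP[_ /eqP /= e]; rewrite e (negPf d0).
by move=> /andP[_ /IH H] /andP[_ /H->].
Qed.

(** Telescoping of [size_level]: a level has as many ones as the next higher level has letters, and
    the top level [K - 1] has a single one. *)
Lemma count_by_level K v i : 0 < K -> first_passage K 0 v -> i < K ->
  count id (by_level K 0 v i.+1) = (size (by_level K 0 v i)).+1.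
Proof.
move=> K0 f; elim: i => [|i IH] iK.
  have e1 : (K - 1).+1 = K by lia.
  by have := size_level (K - 1) f; rewrite e1 (level_oversize f) // eqxx /=; lia.
have {}IH := IH (ltnW iK).
rewrite [by_level _ _ _ i.+2]/= count_cat IH /= size_cat.
have := size_level (K - i.+2) f; rewrite subnSK; last lia.
have -> : (K - i.+1 == K) = false by lia.
rewrite addn0 => ->.
have -> : (0 == K - i.+1) = false by lia.
lia.
Qed.

Lemma last_by_level K v i : first_passage K 0 v -> 0 < i <= K -> last false (by_level K 0 v i).
Proof.
case: i => // i f iK; rewrite /= last_cat.
have jK : K - i.+1 < K by lia.
have := level_neq0 f (j := K - i.+1); rewrite jK leq0n => /(_ isT).
by have := last_level f jK; case: (level _ _ _).
Qed.

Lemma take_by_level K v i i' : i <= i' ->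
  take (size (by_level K 0 v i)) (by_level K 0 v i') = by_level K 0 v i.
Proof.
elim: i' => [|i' IH]; first by rewrite leqn0 => /eqP->.
rewrite leq_eqVlt => /orP[/eqP->|]; first by rewrite take_size.
rewrite ltnS => ii'; rewrite /= take_cat; case: ltnP => [_|ge]; first exact: IH.
have := IH ii'; rewrite take_oversize // => e.
by rewrite e subnn take0 cats0.
Qed.

(** With a 0 in front, the index in question is that of the last letter of level [K - i], a one; by
    [count_by_level], [prev_one] sends it to the last letter of the level above, and from the top
    level to the 0. *)
Lemma one_chain_by_level K v u i : 0 < K -> first_passage K 0 v -> i <= K ->
  one_chain i (false :: by_level K 0 v K ++ u) (size (by_level K 0 v i)).
Proof.
move=> K0 f; elim: i => [|i IH] iK; first by [].
have szK : size (by_level K 0 v i.+1) <= size (by_level K 0 v K).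
  by rewrite -{1}(take_by_level K v iK) size_take_min geq_minr.
have tk : take (size (by_level K 0 v i.+1)) (by_level K 0 v K ++ u) = by_level K 0 v i.+1.
  by rewrite takel_cat // take_by_level.
have pos : 0 < size (by_level K 0 v i.+1).
  by have := count_by_level K0 f iK; case: (by_level K 0 v i.+1).
rewrite one_chainS; apply/andP; split.
  rewrite -(prednK pos) /= -(nth_take (n0 := size (by_level K 0 v i.+1))); last by rewrite prednK.
  by rewrite tk nth_last last_by_level.
by rewrite /prev_one /= tk add0n count_by_level // IH // ltnW.
Qed.

(** Levels end where the chains of lengths 1 to [K] start, and those starts are unique in the word;
    so both sides are cut at the same places. *)
Lemma by_level_inj K v v' u u' : 0 < K -> first_passage K 0 v -> first_passage K 0 v' ->
  by_level K 0 v K ++ u = by_level K 0 v' K ++ u' -> v = v' /\ u = u'.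
Proof.
move=> K0 f f' e.
have sz i : i <= K -> size (by_level K 0 v i) = size (by_level K 0 v' i).
  move=> iK; apply: (@one_chain_inj i (false :: by_level K 0 v K ++ u)); first exact: one_chain_by_level.
  by rewrite e; exact: one_chain_by_level.
move/eqP: (e); rewrite eqseq_cat ?sz // => /andP[/eqP e1 /eqP ->]; split=> //.
have ei i : i <= K -> by_level K 0 v i = by_level K 0 v' i.
  by move=> iK; rewrite -(take_by_level K v iK) -(take_by_level K v' iK) e1 sz.
apply: (level_inj f f') => j; case: (ltnP j K) => jK; last by rewrite !(level_oversize (K := K)).
have iK : K - j <= K by lia.
have := ei _ iK; rewrite -(subnSK jK) /= subnSK // subKn; last lia.
by rewrite ei; [move/eqP; rewrite eqseq_cat // eqxx => /eqP|lia].
Qed.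

(** * Words without long runs of ones *)

Definition norun K v := forall i, exists2 j, j < K & ~~ nth false v (i + j).

Fixpoint norunb K s v : bool :=
  (s < K) && (if v is b :: v' then norunb K (if b then s.+1 else 0) v' else true).

Lemma norun_cat_false K x y :
  norun K (x ++ false :: y) <-> norun K x /\ norun K y.
Proof.
split=> [H|[Hx Hy] i].
  split=> i.
    have [j jK h] := H i; exists j => //; move: h; rewrite nth_cat.
    by case: ltnP => // ge _; rewrite nth_default.
  have [j jK h] := H (size x + i.+1); exists j => //; move: h; rewrite -addnA nth_cat.
  by rewrite ltnNge leq_addr /= addKn addSn.
case: (leqP i (size x)) => ix.
  have [j jK h] := Hx i; case: (ltnP (i + j) (size x)) => ij.
    by exists j => //; rewrite nth_cat ij.
  exists (size x - i); first by lia.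
  by rewrite subnKC // nth_cat ltnn subnn.
have [j jK h] := Hy (i - (size x).+1); exists j => //.
rewrite nth_cat ltnNge (_ : size x <= i + j) /=; last lia.
by rewrite (_ : i + j - size x = (i - (size x).+1 + j).+1) //; lia.
Qed.

Lemma norun_nseq K s : norun K (nseq s true) <-> s < K.
Proof.
split=> [/(_ 0) [j jK]|sK i].
  by rewrite add0n nth_nseq; case: ltnP => // sj _; apply: leq_ltn_trans sj jK.
exists (s - i); first by lia.
by rewrite nth_nseq; case: ltnP => //; lia.
Qed.

Lemma norunbE K s v : norunb K s v <-> norun K (nseq s true ++ v).
Proof.
elim: v s => [|b v IH] s /=; first by rewrite cats0 norun_nseq andbT.
case: b.
  have -> : nseq s true ++ true :: v = nseq s.+1 true ++ v.
    by elim: (s) => //= s' ->.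
  split; first by case/andP=> _ /IH.
  by move=> /IH h; rewrite h andbT; case: (v) h => [|? ?] /= /andP[h _]; lia.
rewrite norun_cat_false norun_nseq; split.
  by case/andP=> -> h; split=> //; apply/(IH 0).
by case=> -> h; apply/(IH 0).
Qed.

Lemma norunP K v : reflect (norun K v) (norunb K 0 v).
Proof. by apply: (iffP idP) => /(norunbE K 0 v). Qed.

(** The first component ends where [K] consecutive ones are first completed, counting [s] ones
    before [v]; without such a run it is all of [v]. *)
Fixpoint passage_cut K s v : seq bool * seq bool :=
  if s == K then ([::], v) else
  if v is b :: v' then
    let c := passage_cut K (if b then s.+1 else 0) v' in (b :: c.1, c.2)
  else ([::], [::]).

Lemma passage_cutP K s v : s <= K -> ~~ norunb K s v ->
  first_passage K s (passage_cut K s v).1 /\ v = (passage_cut K s v).1 ++ (passage_cut K s v).2.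
Proof.
elim: v s => [|b v IH] s sK /=.
  by rewrite andbT -leqNgt => Ks; have e : s = K by [lia]; rewrite e eqxx /= eqxx.
case: (eqVneq s K) => [->|ne] /=; first by rewrite eqxx.
have lt : s < K by lia.
rewrite lt /= => h; have [] := IH (if b then s.+1 else 0) _ h; first by case: (b); lia.
by move=> f e; rewrite f -e.
Qed.

(** * The sorting injection and the run-bounded encoding *)

Definition sort_passage m K (v : m.-tuple bool) : m.-tuple bool :=
  insubd v (by_level K 0 (passage_cut K 0 v).1 K ++ (passage_cut K 0 v).2).

Definition has_chain K d := [exists y : 'I_(size d), one_chain K d y].

(** The injection is [sort_passage K]: the start of the chain of length [K] marks the end of the
    sorted part, and [by_level_inj] undoes the sorting. *)
Lemma card_has_chain m K : 0 < K ->
  #|[set v : m.-tuple bool | ~~ norunb K 0 v]| <= #|[set u : m.-tuple bool | has_chain K (false :: u)]|.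
Proof.
move=> K0; set A := [set v : m.-tuple bool | _].
have szc v : ~~ norunb K 0 v ->
    size (by_level K 0 (passage_cut K 0 v).1 K ++ (passage_cut K 0 v).2) = size v.
  case/(passage_cutP (leq0n K)) => f e.
  by rewrite size_cat size_by_levelK // -size_cat -e.
have val_phi (v : m.-tuple bool) : v \in A ->
    val (sort_passage K v) = by_level K 0 (passage_cut K 0 v).1 K ++ (passage_cut K 0 v).2.
  by rewrite inE => h; rewrite /sort_passage val_insubd szc // size_tuple eqxx.
have inj : {in A &, injective (@sort_passage m K)}.
  move=> v v' vA v'A /(congr1 val); rewrite !val_phi //.
  move: vA v'A; rewrite !inE => /(passage_cutP (leq0n K))[f e] /(passage_cutP (leq0n K))[f' e'] E.
  have [e1 e2] : (passage_cut K 0 v).1 = (passage_cut K 0 v').1 /\ (passage_cut K 0 v).2 = (passage_cut K 0 v').2.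
    move: E; move: (passage_cut K 0 v) (passage_cut K 0 v') f f' {e e'} => [x y] [x' y'] /= f f' E.
    have h1 := one_chain_by_level y K0 f (leqnn K); have h2 := one_chain_by_level y' K0 f' (leqnn K).
    rewrite -E in h2; have sz := one_chain_inj h1 h2.
    exact: by_level_inj f f' E.
  by apply: val_inj; rewrite /= e e' e1 e2.
rewrite -(card_in_imset inj); apply/subset_leq_card/subsetP => _ /imsetP[v vA ->].
have e := val_phi _ vA; rewrite inE /has_chain e.
move: vA; rewrite inE => /(passage_cutP (leq0n K))[f _].
set d := false :: _.
have lt : size (by_level K 0 (passage_cut K 0 v).1 K) < size d by rewrite /= ltnS size_cat leq_addr.
by apply/existsP; exists (Ordinal lt); apply: one_chain_by_level.
Qed.

Definition chainless K d := ~~ nth false d 0 && ~~ has_chain K d.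

Lemma norun_rcons_false K v : norun K v -> norun K (rcons v false).
Proof.
move=> h; rewrite -cats1; apply/norun_cat_false; split=> // i.
by have [j jK _] := h 0; exists j; rewrite ?nth_nil.
Qed.

(** Complement of [card_has_chain]: the fixed first 0 of a chainless word is traded for a last 0,
    which creates no run. *)
Lemma card_chainless n K : 0 < K ->
  #|[set d : n.-tuple bool | chainless K d]| <=
  #|[set v : n.-tuple bool | norunb K 0 v && ~~ last false v]|.
Proof.
case: n => [|m] K0.
  apply: (@leq_trans 1); first by rewrite (leq_trans (max_card _)) // card_tuple expn0.
  by rewrite card_gt0; apply/set0Pn; exists [tuple]; rewrite inE /= K0.
set S := [set u : m.-tuple bool | ~~ has_chain K (false :: u)].
set S' := [set v : m.-tuple bool | norunb K 0 v].
have SS' : #|S| <= #|S'|.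
  have := card_has_chain m K0.
  have := cardsC S'; have := cardsC S.
  have -> : ~: S = [set u : m.-tuple bool | has_chain K (false :: u)].
    by apply/setP=> u; rewrite !inE negbK.
  have -> : ~: S' = [set v : m.-tuple bool | ~~ norunb K 0 v] by apply/setP=> u; rewrite !inE.
  lia.
apply: leq_trans (leq_trans SS' _).
  rewrite -(card_imset S (f := cons_tuple false)); last first.
    by move=> x y [e]; apply: val_inj.
  apply/subset_leq_card/subsetP => d; rewrite inE /chainless => /andP[d0 al].
  apply/imsetP; exists [tuple of behead d]; last first.
    by apply: val_inj; case: d d0 {al} => -[|[] d] //= ? _.
  by rewrite inE; case: d d0 al => -[|[] d] //= ? _.
rewrite -(card_imset S' (f := fun t : m.-tuple bool => [tuple of rcons t false])); last first.
  by move=> x y /(congr1 val)/= /rcons_inj[e]; apply: val_inj.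
apply/subset_leq_card/subsetP => _ /imsetP[v vS ->].
move: vS; rewrite !inE last_rcons andbT => /norunP h.
by apply/norunP; apply: norun_rcons_false.
Qed.

(* No explicit formula is needed: [card_chainless] provides an injection. *)
Definition encode K d : seq bool :=
  nth (in_tuple d) (enum [set v : (size d).-tuple bool | norunb K 0 v && ~~ last false v])
    (index (in_tuple d) (enum [set d' : (size d).-tuple bool | chainless K d'])).

Lemma encodeE K n (t : n.-tuple bool) :
  encode K t = nth t (enum [set v : n.-tuple bool | norunb K 0 v && ~~ last false v])
    (index t (enum [set d' : n.-tuple bool | chainless K d'])).
Proof.
case: t => d e; have e' := eqP e; rewrite /encode /=; subst n.
by have -> : in_tuple d = Tuple e by apply: val_inj.
Qed.

Lemma encode_index_lt K n (t : n.-tuple bool) : 0 < K -> chainless K t ->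
  index t (enum [set d' : n.-tuple bool | chainless K d']) <
  size (enum [set v : n.-tuple bool | norunb K 0 v && ~~ last false v]).
Proof.
move=> K0 h; rewrite -cardE; apply: leq_trans (card_chainless n K0).
by rewrite cardE index_mem mem_enum inE.
Qed.

Lemma size_encode K d : size (encode K d) = size d.
Proof. by rewrite /encode size_tuple. Qed.

Lemma encode_norun K d : 0 < K -> chainless K d -> norun K (encode K d) /\ ~~ last false (encode K d).
Proof.
move=> K0 h; have := encode_index_lt K0 (t := in_tuple d) h.
move/(mem_nth (in_tuple d)); rewrite mem_enum inE => /andP[/norunP]; exact.
Qed.

Lemma encode_inj K d d' : 0 < K -> chainless K d -> chainless K d' -> encode K d = encode K d' -> d = d'.
Proof.
move=> K0 h h' e; have s : size d' = size d by rewrite -(size_encode K) -e size_encode.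
pose t := in_tuple d; pose t' : (size d).-tuple bool := Tuple (introT eqP s).
have {}e : encode K t = encode K t' by [].
have /= i := encode_index_lt K0 (t := t) h; have /= i' := encode_index_lt K0 (t := t') h'.
move: e; rewrite !encodeE => /val_inj; rewrite (set_nth_default t t') // => /eqP.
rewrite nth_uniq ?enum_uniq // => /eqP ii.
have T : t \in enum [set d' : (size d).-tuple bool | chainless K d'] by rewrite mem_enum inE.
have T' : t' \in enum [set d' : (size d).-tuple bool | chainless K d'] by rewrite mem_enum inE.
by have := nth_index t T; rewrite ii nth_index // => /(congr1 val).
Qed.

(** * Counting words up to rotation *)

Lemma nth_rot v i k : i < size v -> k < size v ->
  nth false (rot i v) k = nth false v ((i + k) %% size v).
Proof.
move=> iv kv; rewrite /rot nth_cat size_drop; case: ltnP => h.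
  by rewrite nth_drop modn_small //; lia.
rewrite nth_take; last lia.
congr nth; rewrite -[in RHS](subnK (_ : size v <= i + k)); last lia.
by rewrite modnDr modn_small; lia.
Qed.

Definition unique_run_first N (V : seq bool) := exists K,
  (forall j, j < K -> nth false V j) /\
  (forall i, 0 < i < N -> exists2 j, j < K & ~~ nth false V ((i + j) %% N)).

(** The longer of the two initial runs would reappear in the other word at a nonzero shift, against
    uniqueness there. *)
Lemma unique_run_first_rot N (V V' : N.-tuple bool) e : unique_run_first N V -> unique_run_first N V' -> e < N ->
  (forall k, nth false V (k %% N) = nth false V' ((e + k) %% N)) -> e = 0.
Proof.
move=> [K [h1 h2]] [K' [h1' h2']] eN E.
case: (posnP e) => // e0; exfalso; case: (leqP K K') => KK.
  have [|j jK] := h2 (N - e); first by lia.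
  rewrite E addnA subnKC; last by lia.
  rewrite modnDl modn_small ?h1' //; first by apply: leq_trans KK.
  have := h1' j (leq_trans jK KK); case: (ltnP j N) => // Nj.
  by rewrite nth_default // size_tuple.
have [|j jK] := h2' e; first by lia.
have jK' := ltn_trans jK KK.
rewrite -E modn_small ?h1 //.
have := h1 j jK'; case: (ltnP j N) => // Nj.
by rewrite nth_default // size_tuple.
Qed.

(** All rotations of members of [F] are distinct, and none is constant: the initial run supplies a
    one, and the uniqueness clause at shift 1 a zero. *)
Lemma card_unique_run_first N (F : {set N.-tuple bool}) : 1 < N ->
  (forall V, V \in F -> unique_run_first N V) -> N * #|F| <= 2 ^ N - 2.
Proof.
move=> N1 pF.
pose f (p : N.-tuple bool * 'I_N) : N.-tuple bool := [tuple of rot p.2 p.1].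
have fE V (i : 'I_N) k : nth false (f (V, i)) (k %% N) = nth false V ((i + k) %% N).
  rewrite nth_rot ?size_tuple ?ltn_mod ?modnDmr //; lia.
have inj : {in setX F setT &, injective f}.
  move=> [V i] [V' j]; rewrite !inE /= !andbT => VF V'F e.
  have E k : nth false V (k %% N) = nth false V' ((((N - i) + j) %% N + k) %% N).
    have iN := ltn_ord i.
    have := fE V i (N - i + k); rewrite addnA subnKC; last by lia.
    rewrite modnDl => <-; rewrite e fE modnDml; congr (nth _ _ (_ %% _)); lia.
  have lt : (N - i + j) %% N < N by rewrite ltn_mod; lia.
  have z := unique_run_first_rot (pF _ VF) (pF _ V'F) lt E.
  have ij : i = j.
    apply: val_inj => /=; have iN := ltn_ord i; have jN := ltn_ord j.
    have := divn_eq (N - i + j) N; rewrite z addn0.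
    case: ((N - i + j) %/ N) => [|[|q]]; lia.
  congr (_, _) => //; apply: val_inj; apply: (@eq_from_nth _ false); rewrite ?size_tuple // => k kN.
  by have := E k; rewrite z add0n modn_small.
have -> : N * #|F| = #|f @: setX F setT|.
  by rewrite card_in_imset // cardsX cardsT card_ord mulnC.
pose c0 : N.-tuple bool := [tuple of nseq N false].
pose c1 : N.-tuple bool := [tuple of nseq N true].
have ne : c0 != c1.
  by apply/eqP => /(congr1 (fun t : N.-tuple bool => nth false t 0)); rewrite !nth_nseq; case: ifP => //; lia.
have -> : 2 ^ N - 2 = #|~: [set c0; c1]|.
  have := cardsC [set c0; c1]; rewrite cards2 ne card_tuple card_bool; lia.
apply/subset_leq_card/subsetP => _ /imsetP[[V i] + ->].
rewrite !inE /= andbT => /pF[K [h1 h2]].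
have [|j jK nj] := h2 1; first by lia.
have i0 : 0 < K by lia.
apply/norP; split; apply/eqP => e.
  have := fE V i (N - i); rewrite e nth_nseq subnKC; last by have := ltn_ord i; lia.
  by rewrite modnn h1 // if_same.
have lti := ltn_ord i.
  have := fE V i ((N - i) + (1 + j)); rewrite e nth_nseq.
rewrite (_ : i + (N - i + (1 + j)) = N + (1 + j)); last by lia.
rewrite modnDl (negPf nj) ltn_mod; case: ifP => //; lia.
Qed.

Lemma first_passage_cat_run K s v w : first_passage K s v -> ~~ norunb K s (v ++ w).
Proof.
elim: v s => [|b v IH] s /=.
  by move/eqP->; case: w => [|b w] /=; rewrite ltnn.
by case/andP=> -> /IH.
Qed.

Lemma first_passage_rcons K z : norun K z -> ~ norun K (rcons z true) -> first_passage K 0 (rcons z true).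
Proof.
move=> h /norunP h'; have [f e] := passage_cutP (leq0n K) h'.
case: (lastP (passage_cut K 0 (rcons z true)).2) e => [|w c] e; first by rewrite e cats0.
move: e; rewrite -rcons_cat => /rcons_inj[e _].
by move/norunP: h; rewrite e (negPf (first_passage_cat_run _ f)).
Qed.

(** The map [g] drops the last letter and rotates. It reaches every nonzero [y]: some rotation of
    [y] ends with a longest cyclic run of [k] ones, and an appended 1 completes the first run of
    [k.+1]. *)
Lemma card_first_passage_ge N : 0 < N ->
  2 ^ N - 1 <=
  N * #|[set v : N.+1.-tuple bool | [exists k : 'I_N.+2, (1 < k) && first_passage k 0 v]]|.
Proof.
move=> N0; set F := [set v : N.+1.-tuple bool | _].
pose c0 : N.-tuple bool := [tuple of nseq N false].
pose g (p : N.+1.-tuple bool * 'I_N) : N.-tuple bool := insubd c0 (rotr p.2 (take N p.1)).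
have -> : 2 ^ N - 1 = #|~: [set c0]|.
  by have := cardsC [set c0]; rewrite cards1 card_tuple card_bool; lia.
suff /subset_leq_card/leq_trans : ~: [set c0] \subset g @: setX F setT.
  apply; rewrite (leq_trans (leq_imset_card _ _)) // cardsX cardsT card_ord mulnC //.
apply/subsetP => y; rewrite !inE => y0.
have sy : size y = N by rewrite size_tuple.
(* Some rotation of [y] ends with [k] ones; the bound [k <= N] keeps the maximum meaningful when [y]
   is all ones. *)
pose P k := (k <= N) &&
  [exists i : 'I_N, [forall j : 'I_N, (j < k) ==> nth false (rot i y) (N - j.+1)]].
have exP : exists k, P k.
  by exists 0; rewrite /P leq0n; apply/existsP; exists (Ordinal N0); apply/forallP.
have ubP k : P k -> k <= N by case/andP.
case: (ex_maxnP exP ubP) => k /andP[kN /existsP[i /forallP hi]] kmax.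
have k0 : 0 < k.
  case: posnP => // k0; case/eqP: y0; apply: val_inj => /=.
  apply: (@eq_from_nth _ false); rewrite ?size_nseq // sy => p pN.
  rewrite nth_nseq pN; apply/negbTE/negP => yp.
  suff /kmax : P 1 by rewrite k0.
  rewrite /P N0; apply/existsP; exists (Ordinal (ltn_pmod p.+1 N0)).
  apply/forallP => j; apply/implyP; rewrite ltnS leqn0 => /eqP->.
  rewrite nth_rot sy /= ?ltn_mod //; last by lia.
  rewrite modnDml (_ : p.+1 + (N - 1) = N + p); last by lia.
  by rewrite modnDl modn_small.
set z := rot i y; have sz : size z = N by rewrite size_rot.
(* A run of [k.+1] ones inside [z] could be rotated to the end, against the choice of [k]. *)
have znr : norun k.+1 z.
  move=> q; case: (boolP [exists j : 'I_k.+1, ~~ nth false z (q + j)]).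
    by case/existsP => j h; exists j.
  rewrite negb_exists => /forallP h; exfalso.
  have {}h j : j < k.+1 -> nth false z (q + j).
    by move=> jk; have := h (Ordinal jk); rewrite negbK.
  have qk : q + k < N.
    by have := h k (ltnSn k); case: (ltnP (q + k) N) => // ge; rewrite nth_default ?sz.
  suff /kmax : P k.+1 by rewrite ltnn.
  apply/andP; split; first by lia.
  apply/existsP; exists (Ordinal (ltn_pmod (i + (q + k.+1)) N0)).
  apply/forallP => j; apply/implyP => jk; have jN := ltn_ord j.
  rewrite nth_rot sy /= ?ltn_mod //; last by lia.
  have := h (k - j); rewrite /z nth_rot ?sy //; [|lia].
  rewrite modnDml (_ : i + (q + k.+1) + (N - j.+1) = N + (i + (q + (k - j)))); last by lia.
  by rewrite modnDl; apply; lia.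
have fz : first_passage k.+1 0 (rcons z true).
  apply: first_passage_rcons => // /(_ (N - k))[j jk]; rewrite nth_rcons sz.
  case: ltnP => h; last by rewrite (_ : N - k + j == N) //; lia.
  have lt : N - (N - k + j).+1 < N by lia.
  have := hi (Ordinal lt); rewrite /= (_ : N - (N - k + j).+1 < k); last by lia.
  by rewrite /= (_ : N - (N - (N - k + j).+1).+1 = N - k + j); [move->|lia].
have s1 : size (rcons z true) == N.+1 by rewrite size_rcons sz.
apply/imsetP; exists (Tuple s1, i).
  rewrite !inE andbT; have kN2 : k.+1 < N.+2 by lia.
  by apply/existsP; exists (Ordinal kN2); rewrite /= fz andbT ltnS.
apply: val_inj; rewrite /g val_insubd /= -cats1 take_cat sz ltnn subnn take0 cats0.
by rewrite size_rotr sz eqxx /z rotK.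
Qed.

End Words.

(** * The permutation attached to delta *)
Section Word.
Variables (g : nat) (delta : {ffun 'I_g -> bool}).
Implicit Types (i j : 'I_g).

Definition delta_word : seq bool := [seq delta i | i <- enum 'I_g].
Definition ones m := count id (take m delta_word).

Lemma size_delta_word : size delta_word = g.
Proof. by rewrite size_map size_enum_ord. Qed.

Lemma nth_delta_word i : nth false delta_word i = delta i.
Proof. by rewrite (nth_map i) ?size_enum_ord // nth_ord_enum. Qed.

Lemma onesS m : m < g -> ones m.+1 = ones m + nth false delta_word m.
Proof.
move=> mg; rewrite /ones (take_nth false) ?size_delta_word // -cats1 count_cat /=.
by rewrite addn0.
Qed.

Lemma ones_ord i : ones i.+1 = ones i + delta i.
Proof. by rewrite onesS // nth_delta_word. Qed.

Lemma ones_le m n : m <= n <= g -> ones m <= ones n <= ones m + (n - m).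
Proof.
case/andP=> mn ng; elim: n mn ng => [|n IH] mn ng; first by have -> : m = 0; lia.
move: mn; rewrite leq_eqVlt => /orP[/eqP->|mn]; first by lia.
have := IH mn (ltnW ng); rewrite onesS //; case: nth; lia.
Qed.

Lemma phiE i : phi delta i = ones i.+1.
Proof.
suff H m : m <= g -> \sum_(j < g | j < m) delta j = ones m by exact: (H i.+1 (ltn_ord i)).
elim: m => [|m IH] mg; first by rewrite /ones take0 big_pred0.
rewrite (bigD1 (Ordinal mg)); last exact: ltnSn.
rewrite (onesS mg) -(IH (ltnW mg)) [RHS]addnC; congr (_ + _).
  by rewrite -[RHS]/(nat_of_bool (nth false delta_word (Ordinal mg))) nth_delta_word.
apply: eq_bigl => j; rewrite -val_eqE /=; lia.
Qed.

Lemma pi_natE i :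
  pi_nat delta i = if delta i then (ones i.+1).-1 else g - (i.+1 - ones i.+1).
Proof. by rewrite /pi_nat phiE. Qed.

Notation s := (pi_perm delta).

Lemma pi_perm_nat i : s i = pi_nat delta i :> nat.
Proof. by rewrite permE. Qed.

(** Values on P lie below the total number of ones and increase; values on Z are at least that total
    and decrease. *)
Lemma pi_lt i j : (s i < s j) =
  if delta i then if delta j then i < j else true else if delta j then false else j < i.
Proof.
have H1 (k : 'I_g) : ones k.+1 <= ones g <= ones k.+1 + (g - k.+1).
  by apply: ones_le; rewrite leqnn andbT; exact: ltn_ord.
have H0 (k : 'I_g) : ones k.+1 <= k.+1.
  by have := @ones_le 0 k.+1; rewrite /ones take0 /= (ltn_ord k) add0n subn0 => /(_ isT).
have H2 (k l : 'I_g) : k < l -> ones k.+1 <= ones l <= ones k.+1 + (l - k.+1).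
  by move=> kl; apply: ones_le; rewrite kl ltnW.
case: (eqVneq i j) => [->|ne]; first by rewrite !ltnn; case: (delta j).
have {}ne : i != j :> nat by [].
have oi := ones_ord i; have oj := ones_ord j.
have := H1 i; have := H1 j; have := H0 i; have := H0 j; have := ltn_ord i; have := ltn_ord j.
have := H2 i j; have := H2 j i.
rewrite !pi_perm_nat !pi_natE; case: (delta i) oi => oi; case: (delta j) oj => oj.
- case: (ltngtP i j) ne => // ij _; lia.
- lia.
- lia.
- case: (ltngtP i j) ne => // ij _; lia.
Qed.

Definition past_run K (y : 'I_g) : bool := [forall k : 'I_K, delta ((s^-1 ^+ k.+1)%g y)].

Lemma past_runS K y : past_run K.+1 y = delta ((s^-1)%g y) && past_run K ((s^-1)%g y).
Proof.
apply/forallP/andP => [H|[h0 /forallP H] [[|k] kK]].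
- split; first by have := H ord0; rewrite /= expg1.
  by apply/forallP => k; have := H (lift ord0 k); rewrite /= expgS permM.
- by rewrite /= expg1.
by have := H (Ordinal (kK : k < K)); rewrite /= [in X in _ -> X]expgS permM.
Qed.

(** Since pi maps P in order onto an initial segment, an index below the image of an element of P is
    itself the image of a smaller element of P; iterate backwards. *)
Lemma past_run_le K (y y' : 'I_g) : y <= y' -> past_run K y' -> past_run K y.
Proof.
elim: K y y' => [|K IH] y y' yy; first by move=> _; apply/forallP => -[].
rewrite !past_runS => /andP[dp pr].
move: (pi_lt ((s^-1)%g y') ((s^-1)%g y)).
rewrite !permKV dp ltnNge yy /=; case: (delta _) => // /esym/negbT.
by rewrite -leqNgt => le; exact: IH le pr.
Qed.

Lemma past_runW K K' y : K' <= K -> past_run K y -> past_run K' y.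
Proof.
move=> KK /forallP H; apply/forallP => k.
by have := H (widen_ord KK k).
Qed.

End Word.

(** * Bad cycles and failure of the reachability condition *)

Section Fail.
Variables (g : nat) (delta : {ffun 'I_g -> bool}).
Implicit Types (i j : 'I_g) (C D : {set 'I_g}) (t : {ffun 'I_g -> bool}).
Notation s := (pi_perm delta).

Lemma sgn1 t i : (sgn t i == 1%R) = ~~ t i.
Proof. by rewrite /sgn; case: (t i). Qed.

Lemma orientationP C t :
  reflect (forall i, i \in C -> t (s i) = (~~ delta i) (+) t i) (is_orientation delta C t).
Proof.
apply: (iffP forall_inP) => H i iC.
  by have := H i iC; rewrite /sgn /eps; case: (delta i); case: (t (s i)); case: (t i).
by rewrite /sgn /eps (H i iC); case: (delta i); case: (t i).
Qed.

Lemma pos_orientationP C t :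
  reflect ((forall i, i \in C -> t (s i) = (~~ delta i) (+) t i) /\
           (forall i, i \in C -> delta i -> ~~ t i)) (is_pos_orientation delta C t).
Proof.
apply: (iffP andP) => -[/orientationP H1 H2]; split=> //.
  move=> i iC di; move/forall_inP: H2 => /(_ i); rewrite sgn1; apply.
  by rewrite !inE iC.
by apply/forall_inP => i; rewrite !inE sgn1 => /andP[iC /H2]; apply.
Qed.

Lemma mem_cycle_pi C i : C \in cycles delta -> (s i \in C) = (i \in C).
Proof.
case/imsetP => x _ ->; rewrite -!eq_porbit_mem.
by have := porbit_perm s 1 i; rewrite expg1 => ->.
Qed.

(** Multiply the orientation relation over [C]: reindexing along pi cancels the nonzero product of
    signs. *)
Lemma epsC_orientation C t : C \in cycles delta -> is_orientation delta C t -> epsC delta C = 1%R.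
Proof.
move=> cC /forall_inP H.
have nz : (\prod_(i in C) sgn t i != 0)%R.
  by apply/GRing.prodf_neq0 => i _; rewrite /sgn; case: (t i).
apply: (GRing.mulIf nz); rewrite GRing.mul1r /epsC -big_split /=.
rewrite [RHS](reindex_inj (@perm_inj _ s)) /=.
rewrite [RHS](eq_bigl (fun i => i \in C)) => [|i]; last exact: mem_cycle_pi.
by apply: eq_bigr => i /H/eqP.
Qed.

Lemma badI C t i : C \in cycles delta -> is_pos_orientation delta C t ->
  i \in C -> delta i -> bad delta C.
Proof.
move=> cC pt iC di; apply/and4P; split=> //.
- by apply/set0Pn; exists i; rewrite !inE iC.
- by case/andP: pt => /(epsC_orientation cC)->.
by apply/existsP; exists t.
Qed.

Lemma bad_pos_orientation C : bad delta C -> is_pos_orientation delta C (orientation_of delta C).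
Proof.
case/and4P => _ _ _ /existsP[t pt]; rewrite /orientation_of.
by case: pickP => //= /(_ t); rewrite pt.
Qed.

(** A nonempty path from a good cycle would end with an arrow into [C]; an empty one would make the
    bad [C] good. *)
Lemma star_no_arrow C : bad delta C -> (forall D, ~~ arrow delta D C) -> ~~ star delta.
Proof.
move=> bC na; apply/forallPn; exists C; rewrite bC /=; apply/existsPn => D.
apply/negP => /andP[gD /connectP[p]]; case/lastP: p => [_ /= e|p E].
  by case/andP: gD => _; rewrite -e bC.
by rewrite rcons_path last_rcons => /andP[_ +] e; rewrite -e (negPf (na _)).
Qed.

(** If the first letter is 1, the first index is a fixed point in P. Its cycle is bad, and no arrow
    enters it because arrows aim at elements of Z. *)
Lemma star_first_zero (g0 : 0 < g) : star delta -> ~~ delta (Ordinal g0).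
Proof.
move=> st; apply/negP => d0; have := st; apply/negP.
set o := Ordinal g0 in d0 *.
have so : s o = o.
  by apply: val_inj; rewrite -[LHS]/(nat_of_ord (s o)) pi_perm_nat pi_natE d0 ones_ord d0 /ones take0.
have Co i : i \in porbit s o -> i = o.
  case/porbitP => k ->; elim: k => [|k IH]; first by rewrite perm1.
  by rewrite expgSr permM IH.
have cC : porbit s o \in cycles delta by apply: imset_f.
apply: (@star_no_arrow (porbit s o)).
  apply: (@badI _ [ffun => false] o) => //; last exact: porbit_id.
  apply/pos_orientationP; split=> i /Co->; last by rewrite ffunE.
  by rewrite !ffunE d0.
move=> D; apply/negP => /and5P[_ _ _ _ /exists_inP[i _ /exists_inP[j]]].
by rewrite !inE => /andP[/Co-> ]; rewrite d0.
Qed.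

(** The cycle runs through [o], [z], [y 1], ..., [y K.-1], with word 00 1^(K-1). The orientation is
    negative only at [z], so an arrow could aim only at [o], below which there is no index. *)
Lemma short_cycle_not_star (o z : 'I_g) (y : nat -> 'I_g) K : 1 < K ->
  o = 0 :> nat -> ~~ delta o -> ~~ delta z -> s o = z -> s z = y 1 -> y K = o ->
  o != z ->
  (forall k, 0 < k < K -> delta (y k) /\ s (y k) = y k.+1) -> ~~ star delta.
Proof.
move=> K1 o0 d_o dz so sz yK oz H.
have Co i : i \in porbit s o -> [\/ i = o, i = z | exists2 k, 0 < k < K & i = y k].
  case/porbitP => n ->; elim: n => [|n]; first by rewrite perm1; constructor 1.
  rewrite expgSr permM => -[->|->|[k kK ->]].
  - by rewrite so; constructor 2.
  - by rewrite sz; constructor 3; exists 1.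
  have [_ ->] := H k kK; case: (ltnP k.+1 K) => kK'; first by constructor 3; exists k.+1.
  by rewrite (_ : k.+1 = K) ?yK; [constructor 1|lia].
have zC : z \in porbit s o by have := mem_porbit s 1 o; rewrite expg1 so.
have yC : y 1 \in porbit s o by have := mem_porbit s 2 o; rewrite expgS expg1 permM so sz.
have [d1 _] := H 1 K1.
have yz k : 0 < k < K -> y k != z.
  by move=> kK; have [dk _] := H k kK; apply: contraNneq dz => <-.
have bC : bad delta (porbit s o).
  apply: (@badI _ [ffun i => i == z] (y 1)) => //; first exact: imset_f.
  apply/pos_orientationP; split=> i /Co[->|->|[k kK ->]]; rewrite ?ffunE.
  - by rewrite so eqxx d_o (negPf oz).
  - by rewrite sz eqxx dz (negPf (yz 1 K1)).
  - have [dk ->] := H k kK; rewrite dk (negPf (yz k kK)) /=.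
    case: (ltnP k.+1 K) => kK'; first by rewrite (negPf (yz _ _)).
    by rewrite (_ : k.+1 = K) ?yK ?(negPf oz) //; lia.
  - by rewrite (negPf d_o).
  - by rewrite (negPf dz).
  by move=> _; exact: yz.
apply: star_no_arrow bC _ => D; apply/negP.
case/and5P => _ _ _ bC /exists_inP[i _ /exists_inP[j]]; rewrite !inE sgn1.
have /pos_orientationP[t1 t2] := bad_pos_orientation bC.
case/andP => /Co[->|->|[k kK ->]]; first by rewrite o0.
  move=> _ /andP[_ nt]; have := t1 _ zC; rewrite sz dz (negPf nt) /= => ty.
  by have := t2 _ yC d1; rewrite ty.
by have [-> _] := H k kK.
Qed.

End Fail.

(** * The lower bound *)
Lemma prev_one_le d y : prev_one d y <= y.
Proof.
rewrite /prev_one; have := count_size id (take y.+1 d); rewrite size_take_min; lia.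
Qed.

(** For [v] of length [N.+1] the sorted word ends with a one. A zero is put in front and that one
    becomes a zero: [take N] drops it, and index [N.+1] gets the default [false]. *)
Definition delta_of_passage N v K : {ffun 'I_N.+2 -> bool} :=
  [ffun i : 'I_N.+2 => nth false (false :: take N (by_level K 0 v K)) i].

Section DeltaOfPassage.
Variables (N K : nat) (v : seq bool).
Hypotheses (K1 : 1 < K) (f : first_passage K 0 v) (sv : size v = N.+1).
Let u := by_level K 0 v K.
Let w0 := false :: take N u.

Let K0 : 0 < K. Proof. exact: ltnW. Qed.
Let su : size u = N.+1. Proof. by rewrite /u size_by_levelK. Qed.
Let size_w0 : size w0 = N.+1. Proof. by rewrite /w0 /= size_take_min su; lia. Qed.

Lemma by_level_rcons : u = rcons (take N u) true.
Proof.
have := last_by_level f (i := K); rewrite K0 leqnn => /(_ isT); rewrite -/u.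
case: (lastP u) su => // x b; rewrite size_rcons last_rcons => -[<-] ->.
by congr rcons; rewrite -cats1 take_size_cat.
Qed.

Let hitu : one_chain K (rcons w0 true) N.+1.
Proof.
have := one_chain_by_level [::] K0 f (leqnn K); rewrite cats0 -/u su.
by rewrite {1}by_level_rcons -rcons_cons.
Qed.

Let word_delta : delta_word (delta_of_passage N v K) = rcons w0 false.
Proof.
apply: (@eq_from_nth _ false); first by rewrite size_delta_word size_rcons size_w0.
move=> i; rewrite size_delta_word => iN.
rewrite (nth_delta_word _ (Ordinal iN)) ffunE nth_rcons size_w0 /= -/w0.
case: ltngtP => // h; first by rewrite nth_default // size_w0 ltnW.
by rewrite h nth_default // size_w0.
Qed.

(** The first index goes to the last one. The last index, now in Z, goes to the number of ones,
    exactly where [prev_one] sent the replaced one; so the chain of length [K] closes up into the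
    cycle of [short_cycle_not_star]. *)
Lemma delta_of_passage_not_star :
  ~~ delta_of_passage N v K ord0 /\ ~~ star (delta_of_passage N v K).
Proof.
set dl := delta_of_passage N v K; set U := rcons w0 true.
have d0 : ~~ dl ord0 by rewrite ffunE.
have dz : ~~ dl ord_max by rewrite ffunE nth_default // size_w0.
split=> //.
pose Y k := iter k (prev_one U) N.+1.
have tkU m : m <= N.+1 -> take m (delta_word dl) = take m U.
  by move=> mN; rewrite word_delta /U -!cats1 !takel_cat ?size_w0.
have onesE m : m <= N.+1 -> ones dl m = count id (take m U).
  by move=> mN; rewrite /ones tkU.
have [hU Yk0] : (forall k, k < K -> nth false U (Y k)) /\ Y K = 0.
  case/andP: hitu => /allP h /eqP e; split=> // k kK; apply: h.
  by rewrite mem_iota.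
have cw0 : count id w0 <= N.
  by have := count_size id (take N u); rewrite /w0 /= size_take_min; lia.
have Y1 : Y 1 = count id w0.
  rewrite /Y /= /prev_one take_oversize; last by rewrite size_rcons size_w0.
  by rewrite /U -cats1 count_cat /= addn1.
have Yle k : 0 < k -> Y k <= N.
  case: k => // k _; elim: k => [|k IH]; first by rewrite Y1.
  by rewrite [Y _]iterS; apply: leq_trans (prev_one_le _ _) IH.
have YS k : Y k.+1 = prev_one U (Y k) by [].
clearbody Y.
apply: (@short_cycle_not_star _ dl ord0 ord_max (fun k => inord (Y k)) K) => //.
- apply: val_inj; rewrite -[LHS]/(nat_of_ord (pi_perm dl ord0)) pi_perm_nat pi_natE (negPf d0).
  by rewrite /= onesE // /U /= take0 /=; lia.
- apply: val_inj; rewrite -[LHS]/(nat_of_ord (pi_perm dl ord_max)) pi_perm_nat pi_natE (negPf dz).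
  rewrite /= /ones take_oversize ?size_delta_word // word_delta -cats1 count_cat /=.
  by rewrite inordK Y1 /w0 /=; [have := cw0; rewrite /w0 /=; lia|have := cw0; rewrite /w0 /=; lia].
- by apply: val_inj; rewrite /= inordK Yk0.
move=> k /andP[k0 kK]; have kN := Yle _ k0.
have vk : nat_of_ord (inord (Y k) : 'I_N.+2) = Y k by rewrite inordK //; lia.
have dk : dl (inord (Y k)).
  rewrite -nth_delta_word vk word_delta nth_rcons size_w0 ltnS kN.
  by have := hU k kK; rewrite /U nth_rcons size_w0 ltnS kN.
split=> //; apply: val_inj.
rewrite -[LHS]/(nat_of_ord (pi_perm dl (inord (Y k)))) pi_perm_nat pi_natE dk vk onesE; last by lia.
by rewrite /= inordK YS // ltnS -YS; apply: leq_trans (Yle _ (ltn0Sn k)) _; lia.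
Qed.

End DeltaOfPassage.

(** As the replaced letter is known, delta gives the sorted word; the length of its chain gives [K],
    and [by_level_inj] gives [v]. *)
Lemma delta_of_passage_inj N K K' v v' : 1 < K -> 1 < K' -> first_passage K 0 v -> first_passage K' 0 v' ->
  size v = N.+1 -> size v' = N.+1 ->
  delta_of_passage N v K = delta_of_passage N v' K' -> v = v'.
Proof.
move=> K1 K1' f f' sv sv' e.
have eu : by_level K 0 v K = by_level K' 0 v' K'.
  rewrite (by_level_rcons K1 f sv) (by_level_rcons K1' f' sv'); congr rcons.
  apply: (@eq_from_nth _ false); first by rewrite !size_take_min !size_by_levelK // sv sv'.
  move=> i; rewrite size_take_min size_by_levelK // sv => iN.
  have iN2 : i.+1 < N.+2 by lia.
  by have := congr1 (fun h : {ffun 'I_N.+2 -> bool} => h (Ordinal iN2)) e; rewrite !ffunE.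
have h := one_chain_by_level [::] (ltnW K1) f (leqnn K).
have h' := one_chain_by_level [::] (ltnW K1') f' (leqnn K').
have KK : K = K' by apply: one_chain_length h _ => //; rewrite eu.
subst K'; apply: (proj1 (by_level_inj (u := [::]) (u' := [::]) (ltnW K1) f f' _)).
by rewrite !cats0.
Qed.

Lemma card_fail_ge N : 0 < N ->
  2 ^ N - 1 <=
  N * #|[set delta : {ffun 'I_N.+2 -> bool} | ~~ delta ord0 && ~~ star delta]|.
Proof.
move=> N0; apply: leq_trans (card_first_passage_ge N0) _; rewrite leq_mul2l; apply/orP; right.
set F := [set v : N.+1.-tuple bool | _].
pose k v := odflt ord0 [pick k : 'I_N.+3 | (1 < k) && first_passage k 0 v].
have kP (v : N.+1.-tuple bool) : v \in F -> 1 < k v /\ first_passage (k v) 0 v.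
  rewrite inE => /existsP[q hq]; rewrite /k; case: pickP => [q' /andP[] //|/(_ (widen_ord (leqnSn _) q))].
  by rewrite hq.
have inj : {in F &, injective (fun v : N.+1.-tuple bool => delta_of_passage N v (k v))}.
  move=> v v' /kP[k1 f] /kP[k1' f'] e; apply: val_inj.
  by apply: delta_of_passage_inj e; rewrite ?size_tuple.
rewrite -(card_in_imset inj); apply/subset_leq_card/subsetP => _ /imsetP[v /kP[k1 f] ->].
by rewrite inE; apply/andP; apply: delta_of_passage_not_star; rewrite ?size_tuple.
Qed.

(** * Runs of the permutation and unreachable bad cycles *)
(* The sign changes at each zero, so [zero_parity a n] means that the n-th element
   of an itinerary [a] starting with sign + has sign -. *)
Fixpoint zero_parity (a : nat -> bool) n : bool :=
  if n is n'.+1 then zero_parity a n' (+) ~~ a n' else false.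

Section Valid.
Variables (g : nat) (delta : {ffun 'I_g -> bool}).
Implicit Types (i j c y : 'I_g) (C D : {set 'I_g}) (t : {ffun 'I_g -> bool}).
Notation s := (pi_perm delta).

Definition itinerary c n : bool := delta ((s ^+ n)%g c).

(* Except for the last clause, which does not mention [c], this depends only on
   the itinerary of [c]. *)
Definition witness c r : Prop :=
  [/\ ~~ delta c, forall n, itinerary c n -> ~~ zero_parity (itinerary c) n, exists n, itinerary c n,
      past_run delta r c & (forall n, ~~ past_run delta r.+1 ((s ^+ n)%g c)) /\
      forall y, ~~ past_run delta r.+2 y].

Lemma past_run_order c : ~~ delta c -> ~~ past_run delta #[s]%g c.
Proof.
apply: contra => /forallP; have o := order_gt0 s.
have lt : #[s]%g.-1 < #[s]%g by rewrite prednK.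
by move=> /(_ (Ordinal lt)); rewrite /= prednK // expgVn expg_order invg1 perm1.
Qed.

Lemma past_run_all K y : past_run delta #[s]%g y -> past_run delta K y.
Proof.
move/forallP => H; apply/forallP => k; have o := order_gt0 s.
have lt : k %% #[s]%g < #[s]%g by rewrite ltn_mod.
have := H (Ordinal lt); rewrite /= {2}(divn_eq k #[s]%g) -addnS expgD mulnC expgM.
by rewrite (_ : (s^-1 ^+ #[s])%g = 1%g) ?expg1n ?mul1g // expgVn expg_order invg1.
Qed.

Lemma past_run0 y : past_run delta 0 y.
Proof. by apply/forallP => -[]. Qed.

Lemma past_run_pi K y : past_run delta K.+1 (s y) = delta y && past_run delta K y.
Proof. by rewrite past_runS permK. Qed.

Lemma past_run_max c : ~~ delta c -> exists r, past_run delta r c && ~~ past_run delta r.+1 c.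
Proof.
move=> dc; have ex : exists r, past_run delta r c by exists 0; exact: past_run0.
have ub m : past_run delta m c -> m <= #[s]%g.
  move=> pm; rewrite leqNgt; apply/negP => /ltnW h.
  by have := past_runW h pm; rewrite (negPf (past_run_order dc)).
case: (ex_maxnP ex ub) => r pr rmax; exists r; rewrite pr /=.
by apply/negP => /rmax; rewrite ltnn.
Qed.

(** From sign + at [c], [zero_parity] follows [t] along the cycle, as [t] changes exactly at
    zeros. *)
Lemma orientation_itinerary C c t : C \in cycles delta -> is_pos_orientation delta C t ->
  c \in C -> ~~ t c -> (exists2 i, i \in C & delta i) ->
  (forall n, itinerary c n -> ~~ zero_parity (itinerary c) n) /\ exists n, itinerary c n.
Proof.
move=> cC /pos_orientationP[t1 t2] iC tc [p pC dp].
have inC n : (s ^+ n)%g c \in C.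
  by elim: n => [|n IH]; rewrite ?perm1 // expgSr permM mem_cycle_pi.
have par n : zero_parity (itinerary c) n = t ((s ^+ n)%g c).
  elim: n => [|n IH] /=; first by rewrite perm1 (negPf tc).
  by rewrite IH expgSr permM t1 // addbC.
split=> [n hn|]; first by rewrite par; apply: t2.
case/imsetP: cC pC iC => x _ -> px cx.
have e : porbit s c = porbit s x by apply/eqP; rewrite eq_porbit_mem.
move: px; rewrite -e.
by case/porbitP => n pn; exists n; rewrite /itinerary -pn.
Qed.

Lemma bad_meets_P C : bad delta C -> exists2 i, i \in C & delta i.
Proof. by case/and4P => _ /set0Pn[i]; rewrite !inE => /andP[iC di]; exists i. Qed.

Lemma bad_cycle C : bad delta C -> C \in cycles delta.
Proof. by case/and4P. Qed.

(** Let [D] be the cycle of the first index. If no good cycle reaches [D], the first index is a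
    witness, as it has the longest run before it. Otherwise the unreachable bad cycle [C] receives
    no arrow from [D], and an end [c] of a longest run on [C] is a witness. *)
Lemma exists_witness (g0 : 0 < g) : ~~ delta (Ordinal g0) -> ~~ star delta ->
  exists c r, witness c r.
Proof.
set o := Ordinal g0 => d0; case/forallPn => C; rewrite negb_imply => /andP[bC /existsPn norunb].
have [p pC dp] := bad_meets_P bC.
(* The least element of P is the predecessor of the first index, so it inherits all but one step of
   the run found there. *)
case: (arg_minnP val dp) => i0 di0 mini.
have si0 : s i0 = o.
  apply: val_inj => /=; set j0 := (s^-1)%g o.
  have sj : s j0 = o by rewrite permKV.
  have /= := pi_lt delta i0 j0; rewrite sj /= di0 ltn0.
  case dj: (delta j0) => // /esym/negbT; rewrite -leqNgt => le.
  suff -> : i0 = j0 by rewrite sj.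
  by apply: val_inj; apply/eqP; rewrite eqn_leq le mini.
have oleq y : o <= y by [].
have [R /andP[pR nR]] := past_run_max d0.
pose D := porbit s i0.
have DC : D \in cycles delta by apply: imset_f.
have i0D : i0 \in D by apply: porbit_id.
case: (boolP [exists C0, good delta C0 && connect (arrow delta) C0 D]) => [rD|/existsPn nrD]; last first.
  have bD : bad delta D.
    by have := nrD D; rewrite connect0 andbT /good DC /= negbK.
  have pt := bad_pos_orientation bD; have /pos_orientationP[t1 t2] := pt.
  have oD : o \in D by rewrite -si0 mem_cycle_pi.
  have to : ~~ orientation_of delta D o by rewrite -si0 t1 // di0 /= t2.
  have [v1 v2] := orientation_itinerary DC pt oD to (bad_meets_P bD).
  exists o, R; split=> //; split=> y; first by apply: contra nR; apply: past_run_le.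
  by apply: contra nR => /(past_run_le (oleq y)); apply: past_runW.
have CC := bad_cycle bC; have pt := bad_pos_orientation bC.
have /pos_orientationP[t1 t2] := pt.
set t := orientation_of delta C in pt t1 t2.
have nrC : ~~ [exists C0, good delta C0 && connect (arrow delta) C0 C] by apply/existsPn.
(* An element of Z of sign + above [i0] would give an arrow from [D] to [C], making [C]
   reachable. *)
have Zlt j : j \in C -> ~~ delta j -> ~~ t j -> j < i0.
  move=> jC dj tj; rewrite ltnNge; apply/negP => le.
  have ne : i0 != j by apply: contraNneq dj => <-.
  have lt : i0 < j by rewrite ltn_neqAle ne le.
  case/existsP: rD => C0 /andP[gC0 con]; case/negP: (nrC).
  apply/existsP; exists C0; rewrite gC0 /=; apply: (connect_trans con); apply: connect1.
  have neDC : D != C.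
    apply/eqP => e; case/negP: nrC; apply/existsP; exists C0.
    by rewrite gC0 -e.
  rewrite /arrow DC CC bC neDC /=.
  apply/exists_inP; exists i0; first by rewrite !inE i0D di0.
  by apply/exists_inP; exists j; rewrite ?inE ?jC ?dj // lt sgn1.
have sC y : y \in C -> s y \in C by move=> yC; rewrite mem_cycle_pi.
have ex : exists m, [exists y in C, past_run delta m y].
  by exists 0; apply/exists_inP; exists p; rewrite ?past_run0.
have ub m : [exists y in C, past_run delta m y] -> m <= #[s]%g.
  case/exists_inP => y yC pm; rewrite leqNgt; apply/negP => h.
  case/negP: nR; apply: past_run_le (oleq y) _.
  by apply: past_run_all; apply: past_runW pm; apply: ltnW.
case: (ex_maxnP ex ub) => r /exists_inP[c cC pc] rmax.
have {}rmax m y : y \in C -> past_run delta m y -> m <= r.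
  by move=> yC py; apply: rmax; apply/exists_inP; exists y.
have r0 : 0 < r.
  by apply: (rmax 1 (s p) (sC _ pC)); rewrite past_run_pi dp past_run0.
have dc : ~~ delta c.
  apply/negP => dc; have := rmax r.+1 (s c) (sC _ cC).
  by rewrite past_run_pi dc pc ltnn => /(_ isT).
have tc : ~~ t c.
  move: pc; rewrite -(prednK r0) past_runS => /andP[dpc _].
  have pcC : (s^-1)%g c \in C by rewrite -(mem_cycle_pi _ CC) permKV.
  by have := t1 _ pcC; rewrite permKV dpc /= => ->; exact: t2.
have [v1 v2] := orientation_itinerary CC pt cC tc (bad_meets_P bC).
exists c, r; split=> //; split=> [n|y].
  have inC : (s ^+ n)%g c \in C by elim: n => [|n IH]; rewrite ?perm1 // expgSr permM sC.
  by apply/negP => h; have := rmax _ _ inC h; rewrite ltnn.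
(* [c] lies below [i0], which has a run of [R.-1] before it; hence [R <= r.+1], and no index has a
   run of [r.+2]. *)
have Rr : R.-1 <= r.
  apply: (rmax _ c cC); apply: past_run_le (ltnW (Zlt c cC dc tc)) _.
  case: R pR {nR} => [|R'] pR /=; first exact: past_run0.
  by move: pR; rewrite -si0 past_run_pi => /andP[].
apply/negP => /(past_run_le (oleq y)) h; case/negP: nR; apply: past_runW h; clear -Rr; lia.
Qed.

(** Minimality settles how [c] compares with other indices of the same itinerary, a comparison that
    letters alone cannot decide. *)
Definition least_witness c r := witness c r /\ forall c' r', witness c' r' -> c <= c'.

(** Backward steps are forward steps modulo the order of pi, so the itinerary also gives the letters
    met backwards. *)
Lemma witness_itinerary c c' r : itinerary c =1 itinerary c' -> witness c r -> witness c' r.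
Proof.
move=> e; have back x k n : delta ((s^-1 ^+ k)%g ((s ^+ n)%g x)) = itinerary x (n + #[s]%g.-1 * k).
  by rewrite /itinerary expgD permM expgM -invg_expg.
have pe K n : past_run delta K ((s ^+ n)%g c) = past_run delta K ((s ^+ n)%g c').
  by apply: eq_forallb => k; rewrite !back e.
have pare : zero_parity (itinerary c) =1 zero_parity (itinerary c').
  by elim=> //= n ->; rewrite e.
case=> [d0 v1 [m v2] v3 [v4 v5]]; split=> //.
- by have := e 0; rewrite /itinerary !perm1 => <-.
- by move=> n; rewrite -e -pare; exact: v1.
- by exists m; rewrite -e.
- by have := pe r 0; rewrite !perm1 => <-.
by split=> // n; rewrite -pe.
Qed.

End Valid.

(** * Recovering delta from a cycle and its complement *)
Lemma ord_inj_rank n (f : 'I_n -> 'I_n) a : injective f -> f a = #|[set b | f b < f a]| :> nat.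
Proof.
move=> fI; rewrite -(card_imset _ fI).
have fb : bijective f by apply: injF_bij.
have -> : [set f b | b in [set b | f b < f a]] = [set x : 'I_n | x < f a].
  apply/setP => x; rewrite inE; apply/imsetP/idP => [[b + ->]|h]; first by rewrite inE.
  by have [h' _ fK] := fb; exists (h' x); rewrite ?inE ?fK.
by rewrite -sum1dep_card -(big_ord_widen n (fun=> 1) (ltnW (ltn_ord (f a)))) sum1_card card_ord.
Qed.

Lemma ord_inj_eq n (f1 f2 : 'I_n -> 'I_n) : injective f1 -> injective f2 ->
  (forall a b, (f1 a < f1 b) = (f2 a < f2 b)) -> f1 =1 f2.
Proof.
move=> i1 i2 H a; apply: val_inj => /=; rewrite (ord_inj_rank a i1) (ord_inj_rank a i2).
by apply: eq_card => b; rewrite !inE H.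
Qed.

(* A pair ordered differently by [E1] and [E2] stays so when pulled back along
   [si], hence forever, so its two elements have the same itinerary. *)
Lemma embedding_unique g (d1 d2 : {ffun 'I_g -> bool}) (E1 E2 : 'I_g -> 'I_g)
    (la : 'I_g -> bool) (si : {perm 'I_g}) :
  injective E1 -> injective E2 ->
  (forall a, d1 (E1 a) = la a) -> (forall a, d2 (E2 a) = la a) ->
  (forall a, pi_perm d1 (E1 a) = E1 (si a)) -> (forall a, pi_perm d2 (E2 a) = E2 (si a)) ->
  (forall a b, a != b -> (forall k, la ((si ^+ k)%g a) = la ((si ^+ k)%g b)) ->
     (E1 a < E1 b) = (E2 a < E2 b)) ->
  d1 = d2.
Proof.
move=> i1 i2 l1 l2 s1 s2 tie.
suff eE : E1 =1 E2.
  have fb : bijective E1 by apply: injF_bij.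
  by apply/ffunP => x; have [h _ fK] := fb; rewrite -(fK x) l1 eE l2.
apply: ord_inj_eq => // a b; have [//|ne] := eqVneq (E1 a < E1 b) (E2 a < E2 b); exfalso.
have step x y : (E1 (si x) < E1 (si y)) != (E2 (si x) < E2 (si y)) ->
    la x = la y /\ (E1 x < E1 y) != (E2 x < E2 y).
  rewrite -!s1 -!s2 !pi_lt !l1 !l2; case: (la x) (la y) => -[] // h; split=> //.
  move: h; case: (eqVneq x y) => [->|xy]; first by rewrite !ltnn.
  have n1 : E1 x != E1 y :> nat by rewrite val_eqE (inj_eq i1).
  have n2 : E2 x != E2 y :> nat by rewrite val_eqE (inj_eq i2).
  by move: n1 n2; case: ltngtP => // _ _; case: ltngtP.
have back k : (E1 ((si^-1 ^+ k)%g a) < E1 ((si^-1 ^+ k)%g b)) !=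
              (E2 ((si^-1 ^+ k)%g a) < E2 ((si^-1 ^+ k)%g b)).
  elim: k => [|k IH]; first by rewrite !perm1.
  by rewrite !expgSr !permM; apply: (proj2 (step _ _ _)); rewrite !permKV.
have all_eq k : la ((si ^+ k)%g a) = la ((si ^+ k)%g b).
  have o := order_gt0 si^-1%g.
  have -> : (si ^+ k = si^-1 ^+ (#[si^-1].-1 * k + #[si^-1].-1).+1)%g.
    by rewrite -addnS prednK // expgD expg_order mulg1 expgM -invg_expg invgK.
  by apply: (proj1 (step _ _ _)); rewrite !expgSr !permM !permKV; exact: back.
case/negP: (ne); apply/eqP; apply: tie => //.
by apply: contraNneq ne => ->; rewrite !ltnn.
Qed.

Section Split.
Variables (g : nat) (delta : {ffun 'I_g -> bool}) (c : 'I_g).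
Notation s := (pi_perm delta).

Definition orbit_seq : seq 'I_g := traject s c #|porbit s c|.
Definition compl_seq : seq 'I_g := [seq i <- enum 'I_g | i \notin porbit s c].

Lemma mem_orbit_seq i : (i \in orbit_seq) = (i \in porbit s c).
Proof. by rewrite porbit_traject. Qed.

Lemma mem_compl_seq i : (i \in compl_seq) = (i \notin porbit s c).
Proof. by rewrite mem_filter mem_enum andbT. Qed.

Lemma uniq_split : uniq (orbit_seq ++ compl_seq).
Proof.
rewrite cat_uniq uniq_traject_porbit filter_uniq ?enum_uniq // andbT.
by apply/hasPn => i; rewrite mem_compl_seq mem_orbit_seq.
Qed.

Lemma uniq_compl_seq : uniq compl_seq.
Proof. by rewrite filter_uniq ?enum_uniq. Qed.

Lemma mem_split i : i \in orbit_seq ++ compl_seq.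
Proof. by rewrite mem_cat mem_orbit_seq mem_compl_seq orbN. Qed.

Lemma size_orbit_seq : size orbit_seq = #|porbit s c|.
Proof. by rewrite size_traject. Qed.

Lemma size_split : size (orbit_seq ++ compl_seq) = g.
Proof.
rewrite -(card_uniqP uniq_split) -[RHS]card_ord; apply: eq_card => i.
by rewrite mem_split.
Qed.

Lemma size_compl_seq : size compl_seq = g - #|porbit s c|.
Proof. by have := size_split; rewrite size_cat size_orbit_seq; lia. Qed.

Lemma mem_compl_seq_pi i : (s i \in compl_seq) = (i \in compl_seq).
Proof. by rewrite !mem_compl_seq mem_cycle_pi // imset_f. Qed.

Lemma nth_compl_seq_lt y y' : y < size compl_seq -> y' < size compl_seq ->
  (nth c compl_seq y < nth c compl_seq y') = (y < y').
Proof.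
have so : sorted (fun i j : 'I_g => i < j) compl_seq.
  apply: sorted_filter; first by move=> i j k; exact: ltn_trans.
  by have := iota_ltn_sorted 0 g; rewrite -val_enum_ord sorted_map.
have H z z' : z < z' -> z' < size compl_seq -> nth c compl_seq z < nth c compl_seq z'.
  move=> zz z's; apply: (sorted_ltn_nth (leT := fun i j : 'I_g => i < j)) => //.
    by move=> i j k; exact: ltn_trans.
  exact: ltn_trans zz z's.
move=> ys y's; case: (ltngtP y y') => [h|h|->]; last by rewrite ltnn.
  exact: H.
by apply/negbTE; rewrite -leqNgt ltnW // H.
Qed.

(** Transporting pi to these positions, as [split_succ], lets two deltas be compared on a common
    index set. *)
Definition split_enum (k : 'I_g) : 'I_g := nth c (orbit_seq ++ compl_seq) k.

Lemma split_enum_inj : injective split_enum.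
Proof.
move=> a b /eqP; rewrite /split_enum nth_uniq ?size_split // ?uniq_split //.
by move/eqP/val_inj.
Qed.

Lemma delta_split_enum k : delta (split_enum k) = nth false (map delta orbit_seq ++ map delta compl_seq) k.
Proof. by rewrite -map_cat (nth_map c) // size_split. Qed.

Lemma split_succ_subproof k : index (s (split_enum k)) (orbit_seq ++ compl_seq) < g.
Proof. by rewrite -[X in _ < X]size_split index_mem mem_split. Qed.

Definition split_succ k : 'I_g := Ordinal (split_succ_subproof k).

Lemma pi_split_enum k : s (split_enum k) = split_enum (split_succ k).
Proof. by rewrite {2}/split_enum nth_index // mem_split. Qed.

Lemma split_succ_inj : injective split_succ.
Proof.
move=> a b e; apply: split_enum_inj; apply: (@perm_inj _ s).
by rewrite !pi_split_enum e.
Qed.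

Lemma split_enum_orbit (k : 'I_g) : k < #|porbit s c| -> split_enum k = (s ^+ k)%g c.
Proof.
by move=> kl; rewrite /split_enum nth_cat size_orbit_seq kl nth_traject // permX.
Qed.

Lemma nth_split_orbit k : k < #|porbit s c| -> nth c (orbit_seq ++ compl_seq) k = (s ^+ k)%g c.
Proof. by move=> kl; rewrite nth_cat size_orbit_seq kl nth_traject // permX. Qed.

Lemma split_succ_orbit (k : 'I_g) : k < #|porbit s c| ->
  split_succ k = (if k.+1 == #|porbit s c| then 0 else k.+1) :> nat.
Proof.
move=> kl; rewrite /= split_enum_orbit // -permM -expgSr; set j := (if _ then _ else _).
have jl : j < #|porbit s c|.
  rewrite /j; case: eqP => [_|/eqP ne]; first exact: leq_ltn_trans kl.
  by rewrite ltn_neqAle ne.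
have jg : j < size (orbit_seq ++ compl_seq) by rewrite size_cat size_orbit_seq; apply: leq_trans jl (leq_addr _ _).
suff -> : ((s ^+ k.+1) c)%g = nth c (orbit_seq ++ compl_seq) j by rewrite index_uniq ?uniq_split.
rewrite nth_split_orbit // /j; case: eqP => // ->.
by rewrite permX iter_porbit perm1.
Qed.

Lemma split_enum_compl (k : 'I_g) : #|porbit s c| <= k -> split_enum k = nth c compl_seq (k - #|porbit s c|).
Proof. by move=> kl; rewrite /split_enum nth_cat size_orbit_seq ltnNge kl. Qed.

Lemma split_succ_compl (k : 'I_g) : #|porbit s c| <= k ->
  split_succ k = #|porbit s c| + index (s (nth c compl_seq (k - #|porbit s c|))) compl_seq :> nat.
Proof.
move=> kl; rewrite /= split_enum_compl // index_cat mem_orbit_seq size_orbit_seq.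
have lt : k - #|porbit s c| < size compl_seq.
  by have := size_split; rewrite size_cat size_orbit_seq; have := ltn_ord k; lia.
have := mem_nth c lt; rewrite -mem_compl_seq_pi; set z := s _.
by rewrite mem_compl_seq => /negPf->.
Qed.

End Split.

Section SplitInj.
Variables (g : nat) (d1 d2 : {ffun 'I_g -> bool}) (c1 c2 : 'I_g) (l : nat).
Notation s1 := (pi_perm d1).
Notation s2 := (pi_perm d2).
Hypotheses (l1 : #|porbit s1 c1| = l) (l2 : #|porbit s2 c2| = l).
Hypothesis ew : map d1 (orbit_seq d1 c1) = map d2 (orbit_seq d2 c2).
Hypothesis eu : map d1 (compl_seq d1 c1) = map d2 (compl_seq d2 c2).

(** By [pi_lt], the order of images within the complement depends only on letters and ranks, so both
    permutations act alike on ranks. *)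
Let rank_eq y : y < g - l ->
  index (s1 (nth c1 (compl_seq d1 c1) y)) (compl_seq d1 c1) = index (s2 (nth c2 (compl_seq d2 c2) y)) (compl_seq d2 c2).
Proof.
have sz1 : size (compl_seq d1 c1) = g - l by rewrite size_compl_seq l1.
have sz2 : size (compl_seq d2 c2) = g - l by rewrite size_compl_seq l2.
have H1 (z : 'I_(g - l)) : s1 (nth c1 (compl_seq d1 c1) z) \in compl_seq d1 c1.
  by rewrite mem_compl_seq_pi mem_nth // sz1.
have H2 (z : 'I_(g - l)) : s2 (nth c2 (compl_seq d2 c2) z) \in compl_seq d2 c2.
  by rewrite mem_compl_seq_pi mem_nth // sz2.
have lt1 (z : 'I_(g - l)) : index (s1 (nth c1 (compl_seq d1 c1) z)) (compl_seq d1 c1) < g - l.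
  by rewrite -[X in _ < X]sz1 index_mem.
have lt2 (z : 'I_(g - l)) : index (s2 (nth c2 (compl_seq d2 c2) z)) (compl_seq d2 c2) < g - l.
  by rewrite -[X in _ < X]sz2 index_mem.
pose f1 z := Ordinal (lt1 z); pose f2 z := Ordinal (lt2 z).
move=> yl; suff e : f1 =1 f2 by have := congr1 val (e (Ordinal yl)).
have fI1 : injective f1.
  move=> z z' /(congr1 val) /= /(congr1 (nth c1 (compl_seq d1 c1))); rewrite !nth_index //.
  move/perm_inj => /eqP; rewrite nth_uniq ?sz1 ?uniq_compl_seq //.
  by move/eqP/val_inj.
have fI2 : injective f2.
  move=> z z' /(congr1 val) /= /(congr1 (nth c2 (compl_seq d2 c2))); rewrite !nth_index //.
  move/perm_inj => /eqP; rewrite nth_uniq ?sz2 ?uniq_compl_seq //.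
  by move/eqP/val_inj.
apply: (ord_inj_eq fI1 fI2) => z z' /=.
rewrite -[LHS](@nth_compl_seq_lt _ d1 c1) ?sz1 // -[RHS](@nth_compl_seq_lt _ d2 c2) ?sz2 // !nth_index // !pi_lt.
rewrite !nth_compl_seq_lt ?sz1 ?sz2 //.
have D (y' : 'I_(g - l)) : d1 (nth c1 (compl_seq d1 c1) y') = d2 (nth c2 (compl_seq d2 c2) y').
  have := congr1 (fun q => nth false q y') eu.
  by rewrite (nth_map c1) ?sz1 // (nth_map c2) ?sz2.
by rewrite !D.
Qed.

Let succ_eq : split_succ d1 c1 =1 split_succ d2 c2.
Proof.
move=> k; apply: val_inj; case: (ltnP k l) => kl.
  by rewrite [LHS]split_succ_orbit ?l1 // [RHS]split_succ_orbit ?l2.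
rewrite [LHS]split_succ_compl ?l1 // [RHS]split_succ_compl ?l2 // rank_eq //.
by have := ltn_ord k; lia.
Qed.

(** Letters and successors agree on positions, so [embedding_unique] leaves only ties. Two
    complement positions compare by rank; a position on the cycle is pulled back to that of [c],
    where minimality decides in both deltas. *)
Lemma least_witness_inj r1 r2 : least_witness d1 c1 r1 -> least_witness d2 c2 r2 -> d1 = d2.
Proof.
move=> [v1 m1] [v2 m2].
pose la (k : 'I_g) := nth false (map d1 (orbit_seq d1 c1) ++ map d1 (compl_seq d1 c1)) k.
have la1 k : d1 (split_enum d1 c1 k) = la k by rewrite delta_split_enum.
have la2 k : d2 (split_enum d2 c2 k) = la k by rewrite delta_split_enum -ew -eu.
pose si := perm (@split_succ_inj _ d1 c1).
have e1 k : s1 (split_enum d1 c1 k) = split_enum d1 c1 (si k) by rewrite pi_split_enum permE.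
have e2 k : s2 (split_enum d2 c2 k) = split_enum d2 c2 (si k) by rewrite pi_split_enum permE succ_eq.
have i1 := @split_enum_inj _ d1 c1; have i2 := @split_enum_inj _ d2 c2.
apply: (embedding_unique i1 i2 la1 la2 e1 e2).
have it1 k n : itinerary d1 (split_enum d1 c1 k) n = la ((si ^+ n)%g k).
  rewrite /itinerary -la1; congr (d1 _); elim: n => [|n IH]; first by rewrite !perm1.
  by rewrite !expgSr !permM -e1 IH.
have it2 k n : itinerary d2 (split_enum d2 c2 k) n = la ((si ^+ n)%g k).
  rewrite /itinerary -la2; congr (d2 _); elim: n => [|n IH]; first by rewrite !perm1.
  by rewrite !expgSr !permM -e2 IH.
suff W (a b : 'I_g) : a < l -> a != b -> (forall k, la ((si ^+ k)%g a) = la ((si ^+ k)%g b)) ->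
    (split_enum d1 c1 a < split_enum d1 c1 b) = (split_enum d2 c2 a < split_enum d2 c2 b).
  move=> a b ab H; case: (ltnP a l) => al; first exact: W.
  case: (ltnP b l) => bl.
    have := W b a bl; rewrite eq_sym ab => /(_ isT) h.
    have {}h := h (fun k => esym (H k)).
    have n1 : split_enum d1 c1 a != split_enum d1 c1 b :> nat by rewrite val_eqE (inj_eq i1).
    have n2 : split_enum d2 c2 a != split_enum d2 c2 b :> nat by rewrite val_eqE (inj_eq i2).
    by move: n1 n2 h; case: ltngtP => // _ _; case: ltngtP.
  rewrite !split_enum_compl ?l1 ?l2 // !nth_compl_seq_lt ?size_compl_seq ?l1 ?l2 //;
    by have := ltn_ord a; have := ltn_ord b; lia.
move=> al ab H.
have l0 : 0 < l by apply: leq_ltn_trans al.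
have g0 : 0 < g by apply: leq_ltn_trans (ltn_ord a).
pose o : 'I_g := Ordinal g0.
have sio n : n < l -> (si ^+ n)%g o = n :> nat.
  elim: n => [|n IH] nl; first by rewrite perm1.
  have {}IH := IH (ltnW nl).
  rewrite expgSr permM permE split_succ_orbit IH l1; last exact: ltnW.
  by rewrite (ltn_eqF nl).
have {sio} sia : a = (si ^+ a)%g o by apply: val_inj; rewrite /= sio.
(* Both positions are shifted back by [a] steps, which takes the first to the position of [c]. *)
pose b0 := ((si ^- a)%g b).
have sib : b = (si ^+ a)%g b0 by rewrite /b0 -permM mulVg perm1.
have ob0 : o != b0.
  by apply: contraNneq ab => e; rewrite sia sib e.
have Ho k : la ((si ^+ k)%g o) = la ((si ^+ k)%g b0).
  have -> : (si ^+ k = si ^+ a * si ^+ (#[si].-1 * a + k))%g.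
    rewrite -expgD addnA -mulSn prednK ?order_gt0 //.
    by rewrite expgD expgM expg_order expg1n mul1g.
  by rewrite !permM -sia -sib.
have eo1 : split_enum d1 c1 o = c1 by rewrite split_enum_orbit ?l1 // perm1.
have eo2 : split_enum d2 c2 o = c2 by rewrite split_enum_orbit ?l2 // perm1.
have lt1 : split_enum d1 c1 o < split_enum d1 c1 b0.
  rewrite ltn_neqAle val_eqE (inj_eq i1) ob0 eo1; apply: (m1 _ r1).
  by apply: witness_itinerary v1 => n; rewrite it1 -Ho -it1 eo1.
have lt2 : split_enum d2 c2 o < split_enum d2 c2 b0.
  rewrite ltn_neqAle val_eqE (inj_eq i2) ob0 eo2; apply: (m2 _ r2).
  by apply: witness_itinerary v2 => n; rewrite it2 -Ho -it2 eo2.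
(* Equal letters let [pi_lt] carry the comparison forward; both directions are kept because pi
   reverses the order on Z. *)
suff F n : ((split_enum d1 c1 ((si ^+ n)%g o) < split_enum d1 c1 ((si ^+ n)%g b0)) =
            (split_enum d2 c2 ((si ^+ n)%g o) < split_enum d2 c2 ((si ^+ n)%g b0))) /\
           ((split_enum d1 c1 ((si ^+ n)%g b0) < split_enum d1 c1 ((si ^+ n)%g o)) =
            (split_enum d2 c2 ((si ^+ n)%g b0) < split_enum d2 c2 ((si ^+ n)%g o))).
  by rewrite sia sib; exact: (F a).1.
elim: n => [|n [IH1 IH2]].
  rewrite !perm1 lt1 lt2; split=> //.
  by rewrite !ltnNge (ltnW lt1) (ltnW lt2).
by rewrite !expgSr !permM -!e1 -!e2 !pi_lt !la1 !la2 Ho IH1 IH2.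
Qed.

End SplitInj.

(** * The upper bound *)
(* The itinerary in the double cover by signs: zeros are the elements of Z of
   sign +, so the blocks 00 1^a become 01 1^a. *)
Definition lift_word (a : nat -> bool) k := a k || zero_parity a k.

Section Lift.
Variable a : nat -> bool.
Hypotheses (a0 : ~~ a 0) (ap : forall n, a n -> ~~ zero_parity a n).

Lemma lift_word0 : lift_word a 0 = false.
Proof. by rewrite /lift_word (negPf a0). Qed.

(** After a lifted zero the sign is -, which forces Z and hence a lifted one; after a lifted one the
    sign is +. *)
Lemma lift_wordS k : lift_word a k.+1 = if lift_word a k then a k.+1 else true.
Proof.
rewrite /lift_word /=; have := ap (n := k); have := ap (n := k.+1); rewrite /=.
by case: (a k); case: (a k.+1); case: (zero_parity a k) => //= *; rewrite ?orbF ?orbT //;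
   match goal with H : _ -> _ |- _ => by have := H isT end.
Qed.

Lemma unlift_word k : a k.+1 = lift_word a k && lift_word a k.+1.
Proof.
rewrite lift_wordS; case e: (lift_word a k) => //=.
have := lift_wordS k; rewrite e /lift_word /= => h.
apply/negbTE/negP => h'; have := ap h'; rewrite /=.
by move: e; rewrite /lift_word; case: (a k); case: (zero_parity a k).
Qed.

End Lift.

Section Code.
Variables (g : nat) (delta : {ffun 'I_g -> bool}) (c : 'I_g) (r : nat).
Notation s := (pi_perm delta).
Notation a := (itinerary delta c).
Notation T := (lift_word a).
Notation l := #|porbit s c|.
Hypothesis v : witness delta c r.

Let a0 : ~~ a 0. Proof. by case: v => h _ _ _ _; rewrite /itinerary perm1. Qed.
Let ap n : a n -> ~~ zero_parity a n. Proof. by case: v => _ h _ _ _; exact: h. Qed.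

Lemma past_run_itinerary x K n : (forall k, k < K -> itinerary delta x (n + k)) -> past_run delta K ((s ^+ (n + K))%g x).
Proof.
elim: K => [|K IH] H; first exact: past_run0.
rewrite addnS expgSr permM past_run_pi; apply/andP; split; first exact: H.
by apply: IH => k kK; apply: H; apply: ltnW.
Qed.

Lemma itinerary_past_run x K n k : past_run delta K ((s ^+ n)%g x) -> k < K <= n -> itinerary delta x (n - k.+1).
Proof.
elim: K n k => // K IH [|n] k; first by rewrite ltn0 andbF.
rewrite expgSr permM past_run_pi => /andP[d pK]; case: k => [|k] kK; first by rewrite subSS subn0.
by rewrite subSS; apply: IH.
Qed.

Let r_gt0 : 0 < r.
Proof.
case: v => _ _ [n an] _ [h _]; rewrite lt0n; apply/negP => /eqP r0.
have := h n.+1; rewrite r0 expgSr permM past_run_pi past_run0 andbT; case/negP; exact: an.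
Qed.

Let perl : (s ^+ l)%g c = c. Proof. by rewrite permX iter_porbit. Qed.

Let run_end k : k < r -> k < l -> a (l - k.+1).
Proof.
move=> kr kl; case: v => _ _ _ pr _; apply: (itinerary_past_run (K := minn r l)); last by lia.
by rewrite perl; apply: past_runW pr; apply: geq_minl.
Qed.

Let r_lt_l : r < l.
Proof.
rewrite ltnNge; apply/negP => lr; have l0 : 0 < l by rewrite lt0n card_porbit_neq0.
have := run_end (k := l.-1); rewrite prednK // subnn (negPf a0); move/(_ lr).
by rewrite leqnn => /(_ isT).
Qed.

Let before_run : a (l - r.+1) = false.
Proof.
apply/negbTE/negP => h; case: v => _ _ _ _ [/(_ 0) + _]; rewrite perm1 => /negP; apply.
rewrite -perl -(subnK r_lt_l); apply: past_run_itinerary => k kr.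
case: k kr => [|k] kr; first by rewrite addn0.
rewrite (_ : _ + _ = l - (r - k.+1).+1); last by have := r_lt_l; lia.
by apply: run_end; have := r_lt_l; lia.
Qed.

Let lift_before_run : T (l - r.+1).
Proof.
have e : l - r = (l - r.+1).+1 by have := r_lt_l; lia.
have := unlift_word ap (l - r.+1); rewrite -e.
have -> : a (l - r) by rewrite -(prednK r_gt0); apply: run_end; have := r_lt_l; lia.
by case: (T (l - r.+1)).
Qed.

Lemma size_cycle_ge : r.+2 <= l.
Proof.
rewrite ltn_neqAle r_lt_l andbT; apply/eqP => e.
by have := lift_before_run; rewrite -e subnn lift_word0.
Qed.

(** The final run is preceded by two elements of Z of signs + and -, so the lift ends with 01
    1^r. *)
Lemma lift_word_zero : T (l - r.+2) = false.
Proof.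
have e : l - r.+1 = (l - r.+2).+1 by have := size_cycle_ge; lia.
have := unlift_word ap (l - r.+2); rewrite -e before_run lift_before_run andbT.
by move=> <-.
Qed.

Lemma lift_word_end k : l - r.+2 < k < l -> T k.
Proof.
case/andP=> k1 k2; case: (eqVneq k (l - r.+1)) => [->|ne]; first exact: lift_before_run.
rewrite /lift_word (_ : a k) // (_ : k = l - (l - k).-1.+1); last by lia.
by apply: run_end; lia.
Qed.

(** The last block 01 1^r of the lift is left out, being determined by [r]. *)
Definition leading_blocks := [seq T k | k <- iota 0 (l - r.+2)].

Lemma size_leading_blocks : size leading_blocks = l - r.+2.
Proof. by rewrite size_map size_iota. Qed.

Lemma nth_leading_blocks k : k < l - r.+2 -> nth false leading_blocks k = T k.
Proof. by move=> h; rewrite (nth_map 0) ?size_iota // nth_iota. Qed.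

Lemma leading_blocks_next k : k < size leading_blocks -> ~~ nth false leading_blocks k ->
  k.+1 < size leading_blocks /\ nth false leading_blocks k.+1.
Proof.
rewrite size_leading_blocks => h; rewrite nth_leading_blocks // => Tk.
have TS : T k.+1 by rewrite lift_wordS // (negPf Tk).
have lt : k.+1 < l - r.+2.
  rewrite ltn_neqAle h andbT; apply/eqP => e.
  by have := lift_word_zero; rewrite -e TS.
by rewrite nth_leading_blocks.
Qed.

(** By [unlift_word], [r.+2] consecutive lifted ones would contain [r.+1] consecutive elements of P,
    a run that the witness excludes. *)
Lemma leading_blocks_norun : norun r.+2 leading_blocks.
Proof.
move=> i; case: (boolP [exists j : 'I_r.+2, ~~ nth false leading_blocks (i + j)]).
  by case/existsP => j h; exists j.
rewrite negb_exists => /forallP h; exfalso.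
have H j : j < r.+2 -> T (i + j).
  move=> jr; have := h (Ordinal jr); rewrite negbK /=.
  case: (ltnP (i + j) (l - r.+2)) => [lt|ge]; first by rewrite nth_leading_blocks.
  by rewrite nth_default // size_leading_blocks.
case: v => _ _ _ _ [/(_ (i.+1 + r.+1)) /negP + _]; apply; apply: past_run_itinerary => k kr.
by rewrite addSn unlift_word // H ?andTb -?addnS ?H //; lia.
Qed.

Lemma leading_blocks_head : ~~ nth false leading_blocks 0.
Proof.
case: (posnP (l - r.+2)) => [e|h]; first by rewrite nth_default // size_leading_blocks e.
by rewrite nth_leading_blocks // lift_word0.
Qed.

Notation u := (map delta (compl_seq delta c)).

Lemma count_lt_compl_seq (P : pred 'I_g) y : y < size (compl_seq delta c) ->
  count (fun z => P z && (z < nth c (compl_seq delta c) y)) (compl_seq delta c) = count P (take y (compl_seq delta c)).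
Proof.
move=> ys; rewrite -{2}(cat_take_drop y (compl_seq delta c)) count_cat.
rewrite -[RHS]addn0; congr (_ + _).
  apply: eq_in_count => z zt; have [k] := nthP c zt.
  rewrite size_take_min leq_min => /andP[ky ks] <-.
  by rewrite nth_take // nth_compl_seq_lt // ky andbT.
rewrite -(count_pred0 (drop y (compl_seq delta c))); apply: eq_in_count => z /(nthP c)[k].
rewrite size_drop nth_drop => ks <-; rewrite nth_compl_seq_lt //; last by rewrite -ltn_subRL.
by rewrite ltnNge leq_addr andbF.
Qed.

(** As pi puts P first and keeps its order, the image of an element of P has as rank in the
    complement the number of earlier ones there. *)
Lemma pi_nth_compl_seq y : y < size (compl_seq delta c) -> delta (nth c (compl_seq delta c) y) ->
  s (nth c (compl_seq delta c) y) = nth c (compl_seq delta c) (prev_one u y).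
Proof.
set e := nth c (compl_seq delta c); move=> ys dy.
have sy : s (e y) \in compl_seq delta c by rewrite mem_compl_seq_pi mem_nth.
set q := index (s (e y)) (compl_seq delta c).
have eq : e q = s (e y) by rewrite /e nth_index.
have qs : q < size (compl_seq delta c) by rewrite index_mem.
suff -> : prev_one u y = q by rewrite eq.
have -> : prev_one u y = count delta (take y (compl_seq delta c)).
  rewrite /prev_one -map_take (take_nth c ys) -cats1 map_cat count_cat count_map /=.
  by rewrite -/(e y) dy addn1.
rewrite -(count_lt_compl_seq (delta : pred 'I_g) ys).
have <- : count predT (take q (compl_seq delta c)) = q by rewrite count_predT size_take_min; lia.
rewrite -(count_lt_compl_seq predT qs) -/(e q) eq.
have pe : perm_eq (compl_seq delta c) (map s (compl_seq delta c)).
  apply: uniq_perm; rewrite ?map_inj_uniq ?uniq_compl_seq //; first exact: perm_inj.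
  move=> z; rewrite -{1}(permKV s z) mem_compl_seq_pi -{2}(permKV s z) mem_map //.
  exact: perm_inj.
rewrite [RHS](seq.permP pe) count_map; apply: eq_count => z /=.
by rewrite pi_lt -/(e y) dy; case: (delta z).
Qed.

Lemma one_chain_itinerary K y : y < size (compl_seq delta c) -> one_chain K u y ->
  forall k, k < K -> itinerary delta (nth c (compl_seq delta c) y) k.
Proof.
elim: K y => // K IH y ys; rewrite one_chainS (nth_map c) // => /andP[dy h] [|k] kK.
  by rewrite /itinerary perm1.
rewrite /itinerary expgS permM pi_nth_compl_seq //; apply: IH => //.
exact: leq_ltn_trans (prev_one_le _ _) ys.
Qed.

(** A chain in the complement word is a run of P on a cycle; a first letter 1 would be fixed by
    [prev_one] and give chains of every length. *)
Lemma compl_seq_chainless : chainless r.+2 u.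
Proof.
case: v => _ _ _ _ [_ nor].
have noh y : y < size (compl_seq delta c) -> ~~ one_chain r.+2 u y.
  move=> ys; apply/negP => h; case/negP: (nor ((s ^+ (0 + r.+2))%g (nth c (compl_seq delta c) y))).
  by apply: past_run_itinerary => k kK; exact: (one_chain_itinerary ys h).
rewrite /chainless; apply/andP; split.
  apply/negP => h; have us : 0 < size (compl_seq delta c).
    by rewrite -(size_map delta) lt0n; apply: contraTneq h => /size0nil ->.
  case/negP: (noh 0 us); rewrite /one_chain.
  have it k : iter k (prev_one u) 0 = 0.
    by elim: k => //= k ->; have := prev_one_le u 0; rewrite leqn0 => /eqP.
  by rewrite it eqxx andbT; apply/allP => k _; rewrite it.
by apply/existsPn => y; apply: noh;  rewrite -[X in _ < X](size_map delta) ltn_ord.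
Qed.

(** The initial ones replace the omitted block of the same length [r.+2]; the two separating zeros
    bring the length to [g + 2]. *)
Definition fail_code := nseq r.+2 true ++ leading_blocks ++ [:: false, false & encode r.+2 u].

Lemma porbit_le : l <= g.
Proof. by rewrite -[leqRHS]card_ord max_card. Qed.

Lemma size_fail_code : size fail_code = g + 2.
Proof.
rewrite !size_cat size_nseq size_leading_blocks /= size_encode size_map size_compl_seq.
have H L : r.+2 <= L -> L <= g -> r.+2 + (L - r.+2 + (g - L).+2) = g + 2 by lia.
by apply: H; [exact: size_cycle_ge|exact: porbit_le].
Qed.

(** After the initial ones comes a word [Y] without runs of [r.+2] that starts and ends with a zero.
    A window at a nonzero shift meets the first zero of [Y], an inner one, or the last one if it
    wraps around. *)
Lemma unique_run_first_fail_code : unique_run_first (g + 2) fail_code.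
Proof.
rewrite -size_fail_code /fail_code; set Y := leading_blocks ++ _.
have [en el] := encode_norun (ltn0Sn _) compl_seq_chainless.
have nY : norun r.+2 Y.
  apply/norun_cat_false; split; first exact: leading_blocks_norun.
  by apply/(norun_cat_false r.+2 [::]); split=> // i; exists 0; rewrite ?nth_nil.
have Y0 : ~~ nth false Y 0.
  rewrite /Y; have := leading_blocks_head; case: leading_blocks => //= b bs.
have sY : 1 < size Y by rewrite /Y size_cat /=; lia.
have Yl : ~~ nth false Y (size Y).-1.
  rewrite nth_last /Y last_cat /=.
  by case: (encode r.+2 u) el.
exists r.+2; split=> [j jK|i]; first by rewrite nth_cat size_nseq jK nth_nseq jK.
rewrite size_cat size_nseq => /andP[i0 iN].
have nthY j : r.+2 <= j -> nth false (nseq r.+2 true ++ Y) j = nth false Y (j - r.+2).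
  by move=> jK; rewrite nth_cat size_nseq ltnNge jK.
case: (ltnP i r.+2) => iK.
  exists (r.+2 - i); first by lia.
  rewrite (subnKC (ltnW iK)) modn_small; first by rewrite nthY // subnn.
  by rewrite -[X in X < _]addn0 ltn_add2l (ltnW sY).
have [j jK nj] := nY (i - r.+2).
case: (ltnP (i + j) (r.+2 + size Y)) => h.
  exists j => //; rewrite modn_small // nthY; last by lia.
  by rewrite (_ : i + j - r.+2 = i - r.+2 + j) //; lia.
exists (r.+2 + (size Y).-1 - i); first by lia.
rewrite subnKC; last by lia.
rewrite modn_small; first by rewrite nthY ?addKn // leq_addr.
by rewrite ltn_add2l ltn_predL (ltnW sY).
Qed.

End Code.

(** Every zero of [x] is followed by a one inside [x], so the first two adjacent zeros are the
    separator. *)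
Lemma cat_two_zeros_inj x x' y y' :
  (forall k, k < size x -> ~~ nth false x k -> k.+1 < size x /\ nth false x k.+1) ->
  (forall k, k < size x' -> ~~ nth false x' k -> k.+1 < size x' /\ nth false x' k.+1) ->
  x ++ [:: false, false & y] = x' ++ [:: false, false & y'] -> x = x' /\ y = y'.
Proof.
wlog le : x x' y y' / size x <= size x' => [H|] hx hx' e.
  case: (leqP (size x) (size x')) => le; first exact: H.
  by have [] := H _ _ _ _ (ltnW le) hx' hx (esym e) => -> ->.
move: le; rewrite leq_eqVlt => /orP[/eqP sz|lt].
  by move/eqP: e; rewrite eqseq_cat // => /andP[/eqP-> /eqP[->]].
have N k : nth false (x ++ [:: false, false & y]) k = nth false (x' ++ [:: false, false & y']) k by rewrite e.
have n0 : ~~ nth false x' (size x) by have := N (size x); rewrite !nth_cat ltnn subnn lt => /= <-.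
have [lt1] := hx' _ lt n0.
by have := N (size x).+1; rewrite !nth_cat lt1 ltnNge leqnSn /= subSnn => /= <-.
Qed.

Lemma nseq_cat_false_inj n n' (y y' : seq bool) : ~~ nth false y 0 -> ~~ nth false y' 0 ->
  nseq n true ++ y = nseq n' true ++ y' -> n = n' /\ y = y'.
Proof.
move=> h h'; elim: n n' => [|n IH] [|n'] //=.
- by move=> e; rewrite e in h.
- by move=> e; rewrite -e in h'.
by case=> /IH[-> ->].
Qed.

(** The initial run gives [r], the separator splits the rest, and the blocks together with [r] give
    the length and the letters of the cycle. *)
Lemma fail_code_inj g (d1 d2 : {ffun 'I_g -> bool}) c1 c2 r1 r2 :
  least_witness d1 c1 r1 -> least_witness d2 c2 r2 -> fail_code d1 c1 r1 = fail_code d2 c2 r2 -> d1 = d2.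
Proof.
move=> C1 C2; have [v1 _] := C1; have [v2 _] := C2; rewrite /fail_code.
have hd d c r (w : seq bool) : witness d c r -> ~~ nth false (leading_blocks d c r ++ [:: false, false & w]) 0.
  by move=> v; have := leading_blocks_head v; case: (leading_blocks d c r).
case/nseq_cat_false_inj => [||[er] E]; [exact: hd|exact: hd|].
subst r2; have [eb ee] := cat_two_zeros_inj (@leading_blocks_next _ _ _ _ v1) (@leading_blocks_next _ _ _ _ v2) E.
have eu := encode_inj (ltn0Sn _) (compl_seq_chainless v1) (compl_seq_chainless v2) ee.
have g1 := size_cycle_ge v1; have g2 := size_cycle_ge v2.
have el : #|porbit (pi_perm d1) c1| = #|porbit (pi_perm d2) c2|.
  by have := congr1 size eb; rewrite !size_leading_blocks; lia.
apply: (least_witness_inj (l := #|porbit (pi_perm d2) c2|) el erefl _ eu C1 C2).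
have eT k : k < #|porbit (pi_perm d2) c2| -> lift_word (itinerary d1 c1) k = lift_word (itinerary d2 c2) k.
  move=> kl; case: (ltngtP k (#|porbit (pi_perm d2) c2| - r1.+2)) => h.
  - by rewrite -(nth_leading_blocks h) -eb nth_leading_blocks // el.
  - by rewrite (lift_word_end v1) ?(lift_word_end v2) // ?el h.
  by rewrite h (lift_word_zero v2) -el (lift_word_zero v1).
have ei k : k < #|porbit (pi_perm d2) c2| -> itinerary d1 c1 k = itinerary d2 c2 k.
  case: k => [|k] kl.
    case: v1 v2 => h1 _ _ _ _ [h2 _ _ _ _]; rewrite /itinerary !perm1.
    by rewrite (negPf h1) (negPf h2).
  case: v1 v2 => _ p1 _ _ _ [_ p2 _ _ _].
  by rewrite (unlift_word p1) (unlift_word p2) !eT // ltnW.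
apply: (@eq_from_nth _ false); first by rewrite !size_map !size_orbit_seq.
move=> k; rewrite size_map size_orbit_seq el => kl.
rewrite (nth_map c1) ?size_orbit_seq ?el // (nth_map c2) ?size_orbit_seq //.
by rewrite /orbit_seq !nth_traject ?el // -!permX; exact: ei.
Qed.

Lemma exists_least_witness g (d : {ffun 'I_g -> bool}) c r : witness d c r ->
  exists c r, least_witness d c r.
Proof.
move=> v; pose P n := `[< exists c r, witness d c r /\ c = n :> nat >].
have exP : exists n, P n by exists c; apply/asboolP; exists c, r.
case: (ex_minnP exP) => n /asboolP[c0 [r0 [v0 <-]]] m.
exists c0, r0; split=> // c' r' v'; apply: m; apply/asboolP; by exists c', r'.
Qed.

Lemma card_fail_le g (g0 : 0 < g) :
  (g + 2) * #|[set delta : {ffun 'I_g -> bool} | ~~ delta (Ordinal g0) && ~~ star delta]|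
    <= 2 ^ (g + 2) - 2.
Proof.
set F := [set delta : {ffun 'I_g -> bool} | _].
have /choice[f fP] : forall d, exists V : (g + 2).-tuple bool,
    d \in F -> exists c r, least_witness d c r /\ fail_code d c r = V.
  move=> d; case: (boolP (d \in F)) => [|_]; last by exists [tuple of nseq _ false].
  rewrite inE => /andP[d0 ns]; have [c [r v]] := exists_witness d0 ns.
  have [c' [r' cc]] := exists_least_witness v.
  have sz : size (fail_code d c' r') == g + 2 by rewrite size_fail_code //; case: cc.
  by exists (Tuple sz) => _; exists c', r'.
have inj : {in F &, injective f}.
  move=> d d' /fP[c [r [C e]]] /fP[c' [r' [C' e']]] E.
  by apply: fail_code_inj C C' _; rewrite e e' E.
rewrite -(card_in_imset inj); apply: card_unique_run_first; first by lia.
move=> _ /imsetP[d dF ->]; have [c [r [[v _] <-]]] := fP d dF.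
exact: unique_run_first_fail_code.
Qed.

(** * From cardinals to the bounds and the asymptotics *)

Lemma card_first_zero g (g0 : (0 < g)%N) :
  #|[set delta : {ffun 'I_g -> bool} | ~~ delta (Ordinal g0)]%SET| = (2 ^ (g - 1))%N.
Proof.
set A := finset _.
(* Flipping the first letter exchanges [A] with its complement. *)
pose flip (d : {ffun 'I_g -> bool}) : {ffun 'I_g -> bool} :=
  [ffun i => (i == Ordinal g0) (+) d i].
have flipK : involutive flip by move=> d; apply/ffunP => i; rewrite !ffunE addbA addbb.
have : #|(~: A)%SET| = #|A|.
  rewrite -(card_imset A (inv_inj flipK)); apply: eq_card => d; rewrite !inE negbK.
  apply/idP/imsetP => [h|[d' + ->]]; last by rewrite inE ffunE eqxx.
  by exists (flip d); rewrite ?flipK // inE ffunE eqxx h.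
move=> e.
have : (2 ^ g = 2 * 2 ^ (g - 1))%N by rewrite -expnS; congr expn; lia.
have := cardsC A; rewrite card_ffun card_bool card_ord; lia.
Qed.

Lemma Ng_fail g (g0 : (0 < g)%N) :
  (Ng g + #|[set delta : {ffun 'I_g -> bool} | ~~ delta (Ordinal g0) && ~~ star delta]%SET|)%N
  = (2 ^ (g - 1))%N.
Proof.
rewrite -(card_first_zero g0) /Ng -cardsUI.
rewrite [X in (_ + X)%N](_ : _ = 0)%N ?addn0.
  apply: eq_card => d; rewrite !inE.
  by case: (boolP (star d)) => [/(star_first_zero g0)->|]; rewrite ?andbT.
by apply/eqP; rewrite cards_eq0; apply/eqP/setP => d; rewrite !inE; case: (star d); rewrite ?andbF.
Qed.

From mathcomp Require Import all_classical all_reals all_analysis.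
From mathcomp Require Import lra.

Import Order.TTheory GRing.Theory Num.Theory.
Import numFieldNormedType.Exports.
Local Open Scope classical_set_scope.
Local Open Scope ring_scope.

Lemma fg_bounds (g : nat) : (2 < g)%N -> exists m : nat,
  [/\ fg g = m%:Z, (Ng g + m = 2 ^ (g - 1))%N, (2 ^ (g - 2) - 1 <= (g - 2) * m)%N
    & ((g + 2) * m <= 2 ^ (g + 2) - 2)%N].
Proof.
move=> g3; have g0 : (0 < g)%N by exact: ltnW (ltnW g3).
exists #|[set delta : {ffun 'I_g -> bool} | ~~ delta (Ordinal g0) && ~~ star delta]%SET|.
have e := Ng_fail g0; split=> //; last exact: card_fail_le.
  by rewrite /fg -natrX -e natrD !natz addrC addKr.
move: g0 {e}; case: g g3 => [|[|N]] // N1 g0.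
have /card_fail_ge : (0 < N)%N by [].
rewrite (_ : (N.+2 - 2)%N = N); last by rewrite subn2.
congr (_ <= _ * _)%N; apply: eq_card => d; rewrite !inE.
by congr (~~ d _ && _); apply: val_inj.
Qed.

Theorem theorem4p1 (R : realType) :
  (forall g : nat, (3 <= g)%N ->
     (2 ^+ (g - 2) - 1) / (g%:R - 2) <= (fg g)%:~R :> R /\
     (fg g)%:~R <= (2 ^+ (g + 2) - 2) / (g%:R + 2) :> R) /\
  (fun g : nat => (Ng g)%:R : R^o) ~_\oo (fun g : nat => 2 ^+ (g - 1) : R^o).
Proof.
split=> [g g3|].
  have [m [-> _ h1 h2]] := fg_bounds g3.
  have p1 : (0 : R) < g%:R - 2 by rewrite subr_gt0 ltr_nat.
  have p2 : (0 : R) < g%:R + 2 by rewrite addr_gt0 // ltr0n; lia.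
  rewrite ler_pdivrMr // ler_pdivlMr //; split.
    rewrite -natrX -(natrB _ (ltnW g3)) -(natrB _ (expn_gt0 2 _)) -natrM ler_nat mulnC.
    exact: h1.
  rewrite -natrX -natrD -(natrB _ (_ : 2 <= _)%N) ?ler_nat -?natrM ?ler_nat; last first.
    by rewrite addn2 expnS leq_pmulr // expn_gt0.
  by rewrite mulnC.
apply/eqaddoP => e e0; near=> g.
have g3 : (2 < g)%N by near: g; exact: nbhs_infty_gt.
have [m [_ E _ h]] := fg_bounds g3.
have -> : ((fun g : nat => (Ng g)%:R : R^o) - (fun g : nat => 2 ^+ (g - 1) : R^o)) g = - (m%:R : R).
  rewrite -[LHS]/((Ng g)%:R - 2 ^+ (g - 1) : R).
  by rewrite -natrX -E natrD opprD addrA subrr add0r.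
rewrite normrN !ger0_norm ?exprn_ge0 // ?ler0n //.
have ge : 8 / e <= g%:R.
  near: g; exact: nbhs_infty_ger.
(* The upper bound, with 2^(g+2) = 8 * 2^(g-1); this factor 8 is why [8 / e] is the threshold for
   [g]. *)
have : (m%:R * (g%:R + 2) : R) <= 8 * 2 ^+ (g - 1).
  rewrite -!natrX -natrD -!natrM ler_nat mulnC.
  apply: leq_trans h _; apply: leq_trans (leq_subr _ _) _.
  by rewrite -[8%N]/(2 ^ 3)%N -expnD leq_pexp2l //; lia.
move: ge; rewrite ler_pdivrMr // => ge h'.
have X0 : (0 : R) <= 2 ^+ (g - 1) by exact: exprn_ge0.
have g0 : (0 : R) < g%:R + 2 by rewrite addr_gt0 // ltr0n; lia.
rewrite -(ler_pM2r g0); apply: (le_trans h').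
rewrite mulrAC ler_wpM2r //; nra.
Unshelve. all: end_near.
Qed.
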